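(* Let $G$ be a finite group and assume that the family $\Lambda_1^*(G)$ is known. Then one may determine $|G|$, $d(G)$, $P_G(s)$ and $|\operatorname{Frat}(G)|$, and one may recognize whether or not $G$ is soluble, supersoluble, nilpotent. That is, if $G$ and $H$ are finite groups with $\Lambda_1^*(G)=\Lambda_1^*(H)$, then $|G|=|H|$, $d(G)=d(H)$, $P_G(s)=P_H(s)$, $|\operatorname{Frat}(G)|=|\operatorname{Frat}(H)|$, and $G$ is soluble (respectively supersoluble, nilpotent) if and only if $H$ is soluble (respectively supersoluble, nilpotent).
   Context: For a finite group $G$, $d(G)$ is the smallest cardinality of a generating set of $G$ and $\operatorname{Frat}(G)$ is its Frattini subgroup. The Möbius function $\mu_G$ on the subgroup lattice of $G$ is defined by $\sum_{K\geq H}\mu_G(K)=\delta_{H,G}$ for every $H\leq G$, where $\delta_{G,G}=1$ and $\delta_{H,G}=0$ if $H\neq G$. The Dirichlet polynomial of $G$ is $P_G(s)=\sum_{n\in\mathbb N}a_n(G)/n^s$, where $a_n(G)=\sum_{|G:H|=n}\mu_G(H)$ and $s$ is a complex variable. For non-negative integers $a,b$ (the order of the two indices is immaterial), $\Gamma_{a,b}(G)$ is the undirected graph, possibly with loops, whose vertices are the elements of $G^a\cup G^b$ (a disjoint union if $a\neq b$, just $G^a$ if $a=b$; $G^0$ consists of the single empty tuple), in which $(x_1,\dots,x_a)\in G^a$ and $(y_1,\dots,y_b)\in G^b$ are adjacent if and only if $\langle x_1,\dots,x_a,y_1,\dots,y_b\rangle=G$. If $a\neq b$ there are no other edges; if $a=b$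 there is a loop at $x\in G^a$ exactly when the entries of $x$ generate $G$. A vertex is isolated if it is adjacent to no vertex (itself included). $\Gamma^*_{a,b}(G)$ is obtained from $\Gamma_{a,b}(G)$ by deleting the isolated vertices. $\Lambda_1^*(G)$ is the family of the connected components of the graphs $\Gamma^*_{1,t}(G)$, for all integers $t\geq 0$, regarded as abstract graphs (with their loops) up to isomorphism and counted with multiplicity; the label $t$ from which each graph arises is not part of the data. Thus $\Lambda_1^*(G)=\Lambda_1^*(H)$ means that there is a bijection between the two families matching isomorphic graphs. *)

(* Defs.v *)
From HB Require Import structures.
From mathcomp Require Import all_boot all_order all_algebra all_fingroup.
From mathcomp Require Import all_solvable.
From mathcomp Require Import complex.
From mathcomp Require Import reals sequences exp trigo.

Set Implicit Arguments.
Unset Strict Implicit.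
Unset Printing Implicit Defensive.

Import Order.TTheory GRing.Theory Num.Theory.

Local Open Scope group_scope.

(* [d(G)] is the library's ['m(G)], [Frat(G)] is ['Phi(G)]; solubility and
   nilpotency are the library's [solvable] and [nilpotent]. *)

Section Supersolvable.

Variable gT : finGroupType.

Definition normal_cyclic_factor (G A B : {group gT}) : bool :=
  [&& A <| G, B <| G, A \subset B & cyclic (B / A)].

Definition supersolvable (G : {group gT}) : Prop :=
  exists2 s : seq {group gT},
    path (normal_cyclic_factor G) 1%G s & last 1%G s = G.

End Supersolvable.

Section Moebius.

Variable gT : finGroupType.
Implicit Types G H K : {group gT}.

Local Open Scope ring_scope.

Fixpoint moebius_rec (n : nat) G H : int :=
  if n is n'.+1 then
    (H == G)%:R - \sum_(K : {group gT} | (H \proper K) && (K \subset G))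
                    moebius_rec n' G K
  else 0.

(* Strict chains of subgroups of [G] have at most [#|G|] members, so [#|G|]
   unfoldings suffice; [moebius_sum] is the defining equation. *)
Definition moebius G H : int := moebius_rec #|G| G H.

Lemma moebius_rec_stable m n G H : H \subset G ->
    (#|G| - #|H| < m)%N -> (#|G| - #|H| < n)%N ->
  moebius_rec m G H = moebius_rec n G H.
Proof.
elim: m n H => // m IHm [|n] H //= sHG ltm ltn.
congr (_ - _); apply: eq_bigr => K /andP[ltHK sKG].
have ltc: (#|G| - #|K| < #|G| - #|H|)%N.
  apply: ltn_sub2l; last exact: proper_card.
  exact: leq_trans (proper_card ltHK) (subset_leq_card sKG).
by apply: IHm => //; apply: leq_trans ltc _.
Qed.

Lemma moebius_sum G H : H \subset G ->
  \sum_(K : {group gT} | (H \subset K) && (K \subset G)) moebius G K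
    = (H == G)%:R.
Proof.
move=> sHG; rewrite (bigD1 H) ?subxx //=.
have lt_fuel K : (#|G| - #|K| < #|G|)%N.
  by rewrite ltn_subrL cardG_gt0 cardG_gt0.
rewrite {1}/moebius (@moebius_rec_stable _ #|G|.+1) ?ltnS ?(ltnW (lt_fuel _)) //=.
rewrite -[RHS](subrK (\sum_(K : {group gT} | (H \proper K) && (K \subset G))
                    moebius_rec #|G| G K)); congr (_ + _).
apply: eq_bigl => K; rewrite properEneq [K == H]eq_sym -[H == K]val_eqE /=.
by case: (_ \subset _); case: (_ \subset _); rewrite ?andbT ?andbF.
Qed.

Definition dirichlet_coef G (n : nat) : int :=
  \sum_(H : {group gT} | (H \subset G) && (#|G : H|%g == n)) moebius G H.

Lemma dirichlet_coef_gt G n : (#|G| < n)%N -> dirichlet_coef G n = 0.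
Proof.
move=> ltGn; rewrite /dirichlet_coef big1 // => H /andP[_ /eqP defn].
by move: ltGn; rewrite -defn ltnNge dvdn_leq ?dvdn_indexg.
Qed.

End Moebius.

Section Dirichlet.

Local Open Scope ring_scope.
Local Open Scope complex_scope.

Variable R : realType.

Definition cexp (z : R[i]) : R[i] :=
  (expR (complex.Re z) * cos (complex.Im z))
    +i* (expR (complex.Re z) * sin (complex.Im z)).

Lemma cexpD (y z : R[i]) : cexp (y + z) = cexp y * cexp z.
Proof.
case: y z => [a b] [c d]; rewrite /cexp /= expRD cosD sinD.
by apply/eqP; rewrite eq_complex /=; apply/andP; split; apply/eqP;
  rewrite ?mulrBr ?mulrDr; [congr (_ - _) | rewrite addrC; congr (_ + _)];
  rewrite -!mulrA; congr (_ * _); rewrite mulrCA.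
Qed.

(* Only used for [0 < n], where it is [n ^ s]. *)
Definition natpowC (n : nat) (s : R[i]) : R[i] := cexp (s * (ln n%:R)%:C).

Lemma natpowC_nat (n k : nat) : (0 < n)%N -> natpowC n k%:R = (n ^ k)%:R.
Proof.
move=> n_gt0; rewrite /natpowC mulr_natl.
have cexp0 : cexp 0 = 1.
  by rewrite /cexp /= expR0 cos0 sin0 !mul1r.
elim: k => [|k IHk]; first by rewrite mulr0n cexp0 expn0.
rewrite mulrSr cexpD IHk expnSr natrM; congr (_ * _).
rewrite /cexp /= cos0 sin0 mulr0 mulr1 lnK ?posrE ?ltr0n //.
by rewrite -[LHS]/(n%:R%:C) rmorph_nat.
Qed.

(* The index [#|G : H|] is between 1 and [#|G|], so this finite sum is the whole
   Dirichlet series; see [dirichlet_coef_gt]. *)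
Definition dirichlet_poly (gT : finGroupType) (G : {group gT}) (s : R[i])
    : R[i] :=
  \sum_(1 <= n < #|G|.+1) (dirichlet_coef G n)%:~R / natpowC n s.

End Dirichlet.

Record lgraph := LGraph {
  vertex :> finType;
  adj : rel vertex;
  adjC : symmetric adj
}.

Definition lgraph_iso (X Y : lgraph) : Prop :=
  exists2 f : X -> Y, bijective f & forall x y, adj (f x) (f y) = adj x y.

Section Subgraphs.

Variable X : lgraph.

Definition induced_adj (S : {set X}) : rel {x : X | x \in S} :=
  [rel x y | adj (val x) (val y)].

Lemma induced_adjC (S : {set X}) : symmetric (induced_adj (S := S)).
Proof. by move=> x y; apply: adjC. Qed.

Definition induced (S : {set X}) : lgraph := LGraph (induced_adjC (S := S)).

Definition nonisolated : {set X} := [set x | [exists y, adj x y]].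

Definition components : {set {set X}} :=
  equivalence_partition (connect (@adj X)) [set: X].

End Subgraphs.

Section GeneratingGraph.

Variable gT : finGroupType.

(* A tuple is a sequence together with its length, so the union of [G^a] and
   [G^b] inside sequences is disjoint when [a <> b], and is [G^a] when
   [a = b]. *)
Definition Gamma_vertices (a b : nat) (G : {group gT})
    : {set (maxn a b).-bseq gT} :=
  [set x : (maxn a b).-bseq gT |
    all (mem G) x && ((size x == a) || (size x == b))].

Definition joint_generation (a b : nat) (G : {group gT}) (u v : seq gT) : bool :=
  ((size u == a) && (size v == b) || (size u == b) && (size v == a))
    && (<<[set z in u ++ v]>> == G :> {set gT}).

Lemma joint_generationC a b (G : {group gT}) : symmetric (joint_generation a b G).
Proof.
move=> u v; rewrite /joint_generation orbC ![(size v == _) && _]andbC.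
congr (_ && (<<_>> == _ :> {set gT})).
by apply/setP=> z; rewrite !inE !mem_cat orbC.
Qed.

Definition Gamma_adj (a b : nat) (G : {group gT})
    : rel {x : (maxn a b).-bseq gT | x \in Gamma_vertices a b G} :=
  fun x y => joint_generation a b G (\val x) (\val y).

Lemma Gamma_adjC a b (G : {group gT}) : symmetric (@Gamma_adj a b G).
Proof. by move=> x y; apply: joint_generationC. Qed.

Definition Gamma (a b : nat) (G : {group gT}) : lgraph :=
  LGraph (@Gamma_adjC a b G).

Definition Gamma_star (a b : nat) (G : {group gT}) : lgraph :=
  induced (nonisolated (Gamma a b G)).

(* The multiset of abstract graphs is encoded as an indexed family; the index
   records [t], but [same_Lambda1] does not require it to be preserved. *)
Definition Lambda1_index (G : {group gT}) : Type :=
  {t : nat & {C : {set Gamma_star 1 t G} | C \in components (Gamma_star 1 t G)}}.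

Definition Lambda1 (G : {group gT}) (i : Lambda1_index G) : lgraph :=
  induced (val (projT2 i)).

End GeneratingGraph.

Definition same_Lambda1 (gT hT : finGroupType)
    (G : {group gT}) (H : {group hT}) : Prop :=
  exists2 phi : Lambda1_index G -> Lambda1_index H,
    bijective phi & forall i, lgraph_iso (Lambda1 i) (Lambda1 (phi i)).

(* Main.v *)
Require Import Defs.
From mathcomp Require Import all_boot all_order all_algebra all_fingroup.
From mathcomp Require Import all_solvable.
From mathcomp Require Import finfield mxrepresentation mxabelem.
From mathcomp Require Import complex.
From mathcomp Require Import reals.

Set Implicit Arguments.
Unset Strict Implicit.
Unset Printing Implicit Defensive.

Local Open Scope group_scope.

(** Everything in the conclusion can be read off from one object: the family
    of the maximal subgroups of [G], as a family of subsets of the set [G],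
    without the multiplication.

    That family is visible in the graphs.  When [t] exceeds [#|G|] the graph
    [Gamma_star 1 t G] is connected, since a generating [t]-tuple is adjacent
    to every element of [G].  Hence for each group all but finitely many
    members of the family [Lambda1] are whole graphs [Gamma_star 1 t G], and a
    bijection between two such families must match some [Gamma_star 1 t G] with
    some [Gamma_star 1 s H] where [t] and [s] are both as large as we please
    ([large_labels]); nothing requires [t = s].  Both graphs are connected and
    bipartite, so the isomorphism preserves the two sides or exchanges them, and
    counting vertices shows that an exchange forces both groups to be trivial.
    It therefore restricts to a bijection [f : G -> H] carrying the
    neighbourhoods of tuples to neighbourhoods of tuples.  The neighbourhood of
    a tuple generating [A] is [G] minus the union of the maximal subgroups
    containing [A], so the maximal proper neighbourhoods are the complements of
    the maximal subgroups, and [f] maps the maximal subgroups of [G] onto those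
    of [H] ([same_Lambda1_maximal_bijection]).

    It remains to describe each invariant through the incidences and the orders
    of maximal subgroups and of their intersections.
    - A set generates [G] iff no maximal subgroup contains it, and [Frat(G)] is
      the intersection of the maximal subgroups.
    - By the crosscut theorem the Moebius number of [K] is the signed count of
      the sets of maximal subgroups meeting in [K] ([moebius_crosscut]), so the
      Dirichlet coefficients are signed counts of sets of maximal subgroups whose
      intersection has a given index.
    - [G] is nilpotent iff [M * N = G] for all distinct maximal [M] and [N],
      because a subgroup and its conjugate never factorise [G]; the orders
      of [M], [N] and of their intersection decide whether [M * N = G].
    - By Huppert's theorem [G] is supersoluble iff all its maximal subgroups
      have prime index ([supersolvable_prime_index],
      [prime_index_supersolvable]).
    - Solubility is transported along a chief series of [G].  For [N] normal in
      [G] let [D] be the intersection of the images of the maximal subgroups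
      containing [N].  It is normal in [H]: two maximal subgroups which do not
      factorise the group contain the same normal subgroups of [G], and
      conjugates never factorise.  If [L / N] is a chief factor, a [p]-group,
      then the maximal subgroups of [H] containing the set attached to [N] but
      not the one attached to [L] have [p]-power index, and a Frattini
      argument shows that the corresponding factor of [H] is soluble
      ([p_power_maximals_quo_sol], [max_hull_sol]). *)

(** * Images under a map injective on a set *)

Section ImsetIn.

Variables (aT rT : finType) (f : aT -> rT) (D : {set aT}).
Hypothesis injf : {in D &, injective f}.
Implicit Types A B : {set aT}.

Lemma mem_imset_in A x : A \subset D -> x \in D -> (f x \in f @: A) = (x \in A).
Proof.
move=> /subsetP sAD Dx; apply/imsetP/idP => [[y Ay /injf eq_xy] | ]; last by exists x.
by rewrite (eq_xy Dx (sAD _ Ay)).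
Qed.

Lemma imsetS_in A B : A \subset D -> B \subset D ->
  (f @: A \subset f @: B) = (A \subset B).
Proof.
move=> sAD sBD; apply/idP/idP => [sfAB | ]; last exact: imsetS.
apply/subsetP=> x Ax; rewrite -(mem_imset_in sBD) ?(subsetP sAD) //.
by rewrite (subsetP sfAB) ?imset_f.
Qed.

Lemma imsetI_in A B : A \subset D -> B \subset D ->
  f @: (A :&: B) = f @: A :&: f @: B.
Proof.
move=> /subsetP sAD /subsetP sBD; apply: imsetI => x y /sAD Dx /sBD Dy.
exact: injf.
Qed.

Lemma card_imset_in A : A \subset D -> #|f @: A| = #|A|.
Proof.
move=> /subsetP sAD; apply: card_in_imset => x y /sAD Dx /sAD.
exact: injf.
Qed.

End ImsetIn.

(** * Maximal subgroups, nilpotency and solubility *)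

Section MaximalSubgroups.

Variable gT : finGroupType.
Implicit Types (G H M N E D P L : {group gT}) (p : nat).

Lemma maximal_sub G M : maximal M G -> M \subset G.
Proof. by move/maxgroupp/proper_sub. Qed.

Lemma maximal_eq_sub G M N :
  maximal M G -> maximal N G -> M \subset N -> M :=: N.
Proof.
move=> /maxgroupP[_ maxM] /maxgroupp ltNG sMN.
by apply/esym/maxM.
Qed.

Lemma normal_mul_maximal G M N :
  N <| G -> maximal M G -> ~~ (N \subset M) -> M * N = G.
Proof.
case/andP=> sNG nNG maxM nsNM; have sMG := maximal_sub maxM.
rewrite -norm_joinEl ?(subset_trans sMG) //.
have sNMG : M <*> N \subset G by rewrite join_subG sMG.
have [// | [K maxK]] := maximal_exists sNMG.
rewrite join_subG => /andP[sMK sNK].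
by rewrite (maximal_eq_sub maxM maxK sMK) sNK in nsNM.
Qed.

Lemma index_maximal G M N :
  N <| G -> maximal M G -> ~~ (N \subset M) -> #|G : M| = #|N : N :&: M|.
Proof.
move=> nsNG maxM nsNM.
by rewrite -(normal_mul_maximal nsNG maxM nsNM) indexMg indexgI.
Qed.

Lemma index_maximal_gt1 G M : maximal M G -> 1 < #|G : M|.
Proof. by move/maxgroupp; rewrite indexg_gt1 properE => /andP[]. Qed.

Lemma sub_Phi G N :
  N \subset G -> (forall M, maximal M G -> N \subset M) -> N \subset 'Phi(G).
Proof.
by move=> sNG sNmax; apply/bigcapsP=> M /predU1P[-> | /sNmax].
Qed.

(** The Frattini argument: the normaliser of [P] supplements [E], so a maximal
    subgroup containing this normaliser cannot contain [E], although it contains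
    a full Sylow subgroup of [E]. *)
Lemma Sylow_normal_or_maximal p G E P : E <| G -> p.-Sylow(E) P ->
  P <| G \/ exists M : {group gT}, [/\ maximal M G, ~~ (E \subset M),
                          'N_G(P) \subset M & p^'.-nat #|G : M|].
Proof.
move=> nsEG sylP; have defG := Frattini_arg nsEG sylP.
have sPG : P \subset G := subset_trans (pHall_sub sylP) (normal_sub nsEG).
have [/= NG | [M maxM sNM]] := maximal_exists (subsetIl G 'N(P)).
  by left; rewrite /normal sPG -{1}NG subsetIr.
have sPM : P \subset M by rewrite (subset_trans _ sNM) // subsetI sPG normG.
have nsEM : ~~ (E \subset M).
  apply/negP=> sEM; have := maxgroupp maxM; rewrite properE -{2}defG.
  by rewrite mul_subG ?andbF.
right; exists M; split=> //; rewrite (index_maximal nsEG maxM nsEM).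
apply: (@pnat_dvd _ #|E : P|); last by case/and3P: sylP.
by rewrite indexgS // subsetI (pHall_sub sylP).
Qed.

Lemma nilpotent_normal_Sylow G :
  (forall p P, p.-Sylow(G) P -> P <| G) -> nilpotent G.
Proof.
move=> nsSyl; apply: (nilpotentS _ (Fitting_nil G)).
rewrite -{1}(Sylow_gen G) gen_subG; apply/bigcupsP=> P /SylowP[p _ sylP].
by rewrite Fitting_max ?(nsSyl p) ?(pgroup_nil (pHall_pgroup sylP)).
Qed.

(** Every maximal subgroup contains the Frattini subgroup, so the Frattini
    argument leaves no room for a non-normal Sylow subgroup. *)
Lemma Phi_nilpotent G : nilpotent 'Phi(G).
Proof.
apply: nilpotent_normal_Sylow => p P sylP.
have [nsPG | [M [maxM]]] := Sylow_normal_or_maximal (Phi_normal G) sylP.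
  exact: normalS (pHall_sub sylP) (Phi_sub G) nsPG.
by rewrite Phi_sub_max.
Qed.

End MaximalSubgroups.

Section PrimePowerIndex.

Variable gT : finGroupType.
Implicit Types (G H M N E D P L : {group gT}) (p : nat).

(** Let [P] be a Sylow [p]-subgroup of [E].  A maximal subgroup [M] not containing
    [E] which contains [P] would have index both a power of [p] and prime to
    [p].  So no such [M] exists: the Frattini argument makes [P] normal in [G],
    and then [E / P] lies in every maximal subgroup of [G / P], that is in its
    Frattini subgroup, which is nilpotent. *)
Lemma p_power_maximals_sol p G E : E <| G ->
    (forall M, maximal M G -> ~~ (E \subset M) -> p.-nat #|G : M|) ->
  solvable E.
Proof.
move=> nsEG pmax; have [P sylP] := Sylow_exists p E.
have [sPE pP _] := and3P sylP.
have not_pp' M : maximal M G -> ~~ (E \subset M) -> ~ p^'.-nat #|G : M|.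
  move=> maxM nsEM p'M; have := index_maximal_gt1 maxM.
  by rewrite (pnat_1 (pmax M maxM nsEM) p'M).
have nsPG : P <| G.
  have [// | [M [maxM nsEM _ p'M]]] := Sylow_normal_or_maximal nsEG sylP.
  by case: (not_pp' M maxM nsEM).
rewrite (series_sol (normalS sPE (normal_sub nsEG) nsPG)) (pgroup_sol pP) /=.
apply: nilpotent_sol.
rewrite (nilpotentS _ (Phi_nilpotent (G / P))) //; apply: sub_Phi => [|Mb].
  by rewrite quotientS ?normal_sub.
rewrite -(cosetpreK Mb) quotient_maximal ?(normal_cosetpre Mb) //; move=> maxM.
rewrite quotientS //; apply/idPn=> nsEM; case: (not_pp' _ maxM nsEM).
rewrite (index_maximal nsEG maxM nsEM).
apply: (@pnat_dvd _ #|E : P|); last by case/and3P: sylP.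
by rewrite indexgS // subsetI sPE sub_cosetpre.
Qed.

End PrimePowerIndex.

Section QuotientMaximal.

Variable gT : finGroupType.
Implicit Types (G H M N E D P L : {group gT}) (p : nat).

Lemma maximal_quotient_lift G N (Mb : {group coset_of N}) :
    N <| G -> maximal Mb (G / N) ->
  exists M : {group gT}, [/\ maximal M G, N \subset M, M / N = Mb
                           & #|G / N : Mb| = #|G : M|].
Proof.
move=> nsNG; rewrite -(cosetpreK Mb); pose M := (coset N @*^-1 Mb)%G.
have nsNM : N <| M by apply: normal_cosetpre.
rewrite (@quotient_maximal _ N M G) //= => maxM; exists M; split=> //.
  exact: normal_sub.
apply: index_quotient_eq (maximal_sub maxM) (normal_norm nsNG).
by rewrite subIset // (normal_sub nsNM) orbT.
Qed.

Lemma p_power_maximals_quo_sol p G D E : D <| G -> E <| G -> D \subset E ->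
    (forall M, maximal M G -> D \subset M -> ~~ (E \subset M) ->
       p.-nat #|G : M|) ->
  solvable (E / D).
Proof.
move=> nsDG nsEG sDE pmax; apply: (@p_power_maximals_sol _ p (G / D)).
  exact: quotient_normal.
move=> Mb /(maximal_quotient_lift nsDG)[M [maxM sDM defMb ->]] nsEM.
by apply: pmax => //; apply: contra nsEM => /(quotientS D); rewrite defMb.
Qed.

End QuotientMaximal.

Section Factorisations.

Variable gT : finGroupType.
Implicit Types (G H M N E D P L : {group gT}) (p : nat).

(** If [x = a * m ^ x] with [a] and [m] in [M], then [x = m * a]: a proper
    subgroup and its conjugate never factorise the group. *)
Lemma mulg_conj_eq G M x : x \in G -> M * (M :^ x) = G -> x \in M.
Proof.
move=> Gx defG; move: Gx; rewrite -defG => /mulsgP[a _ Ma /imsetP[m Mm ->] defx].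
have e : a * x^-1 * m = 1.
  by apply: (mulIg x); rewrite mul1g [RHS]defx conjgE !mulgA.
move/eqP: e; rewrite -eq_invg_mul invMg invgK => /eqP defm.
by rewrite -(mulgKV a x) defm groupM.
Qed.

(** The order form of [M * N = G], which only involves cardinals and is therefore
    invariant under bijections that respect [M] and [N]. *)
Definition factorise G M N := (#|M| * #|N| == #|G| * #|M :&: N|)%N.

Lemma factoriseP G M N : M \subset G -> N \subset G ->
  reflect (M * N = G) (factorise G M N).
Proof.
move=> sMG sNG; rewrite /factorise mul_cardG eqn_pmul2r ?cardG_gt0 //.
apply: (iffP eqP) => [eqc | ->]; last by [].
by apply/eqP; rewrite eqEcard eqc leqnn mul_subG.
Qed.

Lemma nilpotent_maximal_normal G M : nilpotent G -> maximal M G -> M <| G.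
Proof.
move=> nilG maxM; have sMG := maximal_sub maxM.
rewrite /normal sMG; have sMN : M \subset 'N_G(M) by rewrite subsetI sMG normG.
have [eqN|[K maxK sNK]] := maximal_exists (subsetIl G 'N(M)).
  by rewrite -{1}eqN subsetIr.
have eqM := maximal_eq_sub maxM maxK (subset_trans sMN sNK).
rewrite -eqM in sNK; have eqG := nilpotent_sub_norm nilG sMG sNK.
by rewrite {1}eqG normG.
Qed.

Lemma nilpotent_factorise G M N :
  nilpotent G -> maximal M G -> maximal N G -> M :!=: N -> factorise G M N.
Proof.
move=> nilG maxM maxN neqMN; apply/factoriseP; rewrite ?maximal_sub //.
apply: normal_mul_maximal => //; first exact: nilpotent_maximal_normal.
by apply: contra neqMN => sNM; rewrite (maximal_eq_sub maxN maxM sNM).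
Qed.

(** A non-normal maximal subgroup would be distinct from one of its conjugates and
    factorise [G] with it, so all maximal subgroups are normal; by the Frattini
    argument none of them can then contain the normaliser of a Sylow subgroup. *)
Lemma factorise_nilpotent G :
    (forall M N, maximal M G -> maximal N G -> M :!=: N -> factorise G M N) ->
  nilpotent G.
Proof.
move=> facG.
have nsmax M : maximal M G -> M <| G.
  move=> maxM; have sMG := maximal_sub maxM; rewrite /normal sMG.
  apply/subsetP=> x Gx; rewrite inE.
  have maxMx : maximal (M :^ x) G by rewrite -(conjGid Gx) maximalJ.
  have [-> // | neq] := eqVneq (M :^ x) M.
  have sMxG := maximal_sub maxMx.
  have fac : factorise G M (M :^ x)%G by apply: facG => //; rewrite eq_sym.
  have Mx := mulg_conj_eq Gx (factoriseP sMG sMxG fac).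
  by rewrite conjGid.
apply: nilpotent_normal_Sylow => p P sylP.
have [// | [M [maxM _ sNM _]]] := Sylow_normal_or_maximal (normal_refl G) sylP.
have sPM : P \subset M.
  by rewrite (subset_trans _ sNM) // subsetI normG (pHall_sub sylP).
have sylPM := pHall_subl sPM (maximal_sub maxM) sylP.
have /= defG := Frattini_arg (nsmax M maxM) sylPM.
by have := maxgroupp maxM; rewrite properE -{2}defG mul_subG ?andbF.
Qed.

End Factorisations.
(** * Supersolubility and Huppert's theorem *)

Section SupersolvableIndex.

Variable gT : finGroupType.
Implicit Types G M A B C : {group gT}.

Lemma normal_between_cyclic G A B C :
    A <| G -> B <| G -> A \subset C -> C \subset B -> cyclic (B / A) ->
  C <| G.
Proof.
move=> nsAG nsBG sAC sCB cycBA.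
have nsAC : A <| C.
  by rewrite (normalS sAC _ nsAG) // (subset_trans sCB) ?normal_sub.
rewrite -(quotientGK nsAC) -(quotientGK nsAG) cosetpre_normal.
apply: (@char_normal_trans _ (B / A)%G); last exact: quotient_normal.
by rewrite sub_cyclic_char // quotientS.
Qed.

(** Some factor [B / A] of a normal series with cyclic factors has [A] inside [M]
    and [B] not.  Then [#|G : M|] is the order of the cyclic group
    [B / (B :&: M)], and any intermediate [C] is again normal in [G].  If
    [#|C : B :&: M|] is prime, then [C] is not contained in [M] and meets it in
    [B :&: M], so this prime is [#|G : M|]. *)
Lemma supersolvable_prime_index G M :
  supersolvable G -> maximal M G -> prime #|G : M|.
Proof.
case=> s; have : 1%G \subset M by rewrite sub1G.
elim: s 1%G => [|B s IHs] A /= sAM.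
  move=> _ eqG maxM; move/maxgroupp: (maxM); rewrite properE => /andP[_].
  by rewrite -eqG sAM.
case/andP=> /and4P[nsAG nsBG sAB cycBA] path_s last_s maxM.
have [sBM | nsBM] := boolP (B \subset M); first exact: IHs sBM path_s last_s maxM.
have sKB : B :&: M \subset B := subsetIl B M.
have sAK : A \subset B :&: M by rewrite subsetI sAB.
have nsKG := normal_between_cyclic nsAG nsBG sAK sKB cycBA.
have nKB : B \subset 'N(B :&: M).
  exact: subset_trans (normal_sub nsBG) (normal_norm nsKG).
have gt1 : 1 < #|B / (B :&: M)|.
  rewrite card_quotient // -(index_maximal nsBG maxM nsBM).
  exact: index_maximal_gt1.
have [x Bx ox] := Cauchy (pdiv_prime gt1) (pdiv_dvd _).
pose C := (coset (B :&: M) @*^-1 <[x]>)%G.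
have sKC : B :&: M \subset C by rewrite normal_sub // normal_cosetpre.
have sCB : C \subset B by rewrite sub_cosetpre_quo ?cycle_subG // /normal sKB.
have nsCG : C <| G.
  exact: normal_between_cyclic nsAG nsBG (subset_trans sAK sKC) sCB cycBA.
have iCK : #|C : B :&: M| = pdiv #|B / (B :&: M)|.
  rewrite -card_quotient ?normal_norm ?normal_cosetpre //.
  by rewrite cosetpreK.
have nsCM : ~~ (C \subset M).
  apply/negP=> sCM; have := pdiv_prime gt1.
  rewrite -iCK; have -> : C :=: B :&: M; last by rewrite indexgg.
  by apply/eqP; rewrite eqEsubset sKC subsetI sCB sCM.
rewrite (index_maximal nsCG maxM nsCM).
have -> : C :&: M = B :&: M.
  by apply/eqP; rewrite eqEsubset setSI //= subsetI sKC subsetIr.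
by rewrite iCK pdiv_prime.
Qed.

End SupersolvableIndex.

Section PrimeIndex.

Variable gT : finGroupType.
Implicit Types G M N P : {group gT}.

Lemma prime_index_quotient G N : N <| G ->
    (forall M, maximal M G -> prime #|G : M|) ->
  forall Mb : {group coset_of N}, maximal Mb (G / N) -> prime #|G / N : Mb|.
Proof.
move=> nsNG primeG Mb /(maximal_quotient_lift nsNG)[M [maxM _ _ ->]].
exact: primeG.
Qed.

(** If a maximal subgroup [M] contains the normaliser of [P], then the indices of
    this normaliser in [G] and in [M] are numbers of Sylow [p]-subgroups, hence
    1 modulo [p].  So [#|G : M|] is also 1 modulo [p], which is impossible for
    a prime which is at most [p]. *)
Lemma prime_index_Sylow_normal G P :
    (forall M, maximal M G -> prime #|G : M|) ->
  (max_pdiv #|G|).-Sylow(G) P -> P <| G.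
Proof.
move=> primeG; set p := max_pdiv _ => sylP.
have [G1 | ntG] := eqVneq G 1%G.
  by have := pHall_sub sylP; rewrite G1 => /trivGP->; apply: normal_refl.
have p_pr : prime p by rewrite max_pdiv_prime // cardG_gt1.
have [// | [M [maxM _ sNM _]]] := Sylow_normal_or_maximal (normal_refl G) sylP.
have sMG := maximal_sub maxM; have q_pr := primeG M maxM.
have sPM : P \subset M.
  by rewrite (subset_trans _ sNM) // subsetI normG (pHall_sub sylP).
have sylPM : p.-Sylow(M) P := pHall_subl sPM sMG sylP.
have eqNM : 'N_M(P) = 'N_G(P).
  by apply/eqP; rewrite eqEsubset setSI //= subsetI sNM subsetIr.
have := card_Syl_mod G p_pr; rewrite (card_Syl sylP) => modG.
have := card_Syl_mod M p_pr; rewrite (card_Syl sylPM) eqNM => modM.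
have q1 : #|G : M| %% p = 1%N.
  by rewrite -modG -(Lagrange_index sMG sNM) -modnMmr modM muln1.
have le_qp : #|G : M| <= p.
  by apply: max_pdiv_max; rewrite mem_primes q_pr cardG_gt0 dvdn_indexg.
move: q1; rewrite leq_eqVlt in le_qp; case/predU1P: le_qp => [-> | lt_qp].
  by rewrite modnn.
by rewrite modn_small // => q1; rewrite q1 in q_pr.
Qed.

End PrimeIndex.

Section PowerAction.

Import GRing.Theory.

Variable gT : finGroupType.
Implicit Types (G C L Q : {group gT}) (p : nat).

(** On the vector space [L] over the prime field the action of [x] is a root of
    [X ^ p - X], which splits into linear factors over that field, so it has an
    eigenvector. *)
Lemma eigenvector_exp p L x :
    p.-abelem L -> L :!=: 1 -> x \in 'N(L) -> x ^+ p.-1 \in 'C(L) ->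
  exists n, [/\ n \in L, n != 1 & exists a, n ^ x = n ^+ a].
Proof.
move=> abL ntL nLx cLx; have pL := abelem_pgroup abL.
have [p_pr _ _] := pgroup_pdiv pL ntL.
have nLX : <[x]> \subset 'N(L) by rewrite cycle_subG.
have Xx := cycle_id x.
pose rL := abelem_repr abL ntL nLX; pose A := rL x.
have A1 : (A ^+ p.-1 = 1)%R.
  rewrite -repr_mxX //; apply/row_matrixP => i; apply: (@rVabelem_inj _ _ _ abL ntL).
  rewrite !rowE mulmx1 rVabelemJ ?groupX //.
  by rewrite conjgE -(centP cLx) ?mulKg // mem_rVabelem.
have Ap : (A ^+ p = A)%R.
  have expS k : k > 0 -> (A ^+ k = A * A ^+ k.-1)%R by case: k => // k; rewrite exprS.
  by rewrite expS ?prime_gt0 // A1 mulr1.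
have prodA : (\prod_(a : 'F_p) (A - a%:M) = 0)%R.
  have := congr1 (horner_mx A) (finField_genPoly 'F_p).
  rewrite card_Fp // rmorphB rmorph_prod /= rmorphXn /= horner_mx_X.
  rewrite Ap subrr => prod0.
  rewrite [RHS]prod0; apply: eq_bigr => a _.
  by rewrite rmorphB /= horner_mx_X horner_mx_C.
have [a _ /det0P[v nzv vA]] : exists2 a : 'F_p, true & (\det (A - a%:M) == 0)%R.
  apply/prodf_eq0; rewrite -(big_morph _ (@det_mulmx _ _) (@det1 _ _)).
  by rewrite prodA det0.
exists (rVabelem abL ntL v); split; first exact: mem_rVabelem.
  by apply: contra nzv => /eqP v1; rewrite -(rVabelemK abL ntL v) v1 abelem_rV_1.
exists a; rewrite -(rVabelemJ abL ntL nLX) // -/rL -/A.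
rewrite -rVabelemZ; congr (rVabelem _ _ _).
by apply/eqP; rewrite -subr_eq0 -mul_mx_scalar -mulmxBr vA.
Qed.

(** Each [x] in [Q] has an eigenvector in [L]; as [Q] acts on [L] through an
    abelian group, the corresponding eigenspace is invariant under [G] and hence
    all of [L].  So every element of [G] acts on [L] as a power map, [G]
    normalises every subgroup of [L], and [L] is generated by any of its
    nontrivial elements. *)
Lemma minnormal_power_prime p G L C Q :
    minnormal L G -> p.-abelem L -> C * Q = G -> C \subset 'C(L) ->
    {in Q &, forall x y, [~ x, y] \in 'C(L)} ->
    {in Q, forall x, x ^+ p.-1 \in 'C(L)} ->
  #|L| = p.
Proof.
move=> minL abL defG cCL cQQ cQp; have /andP[ntL nLG] := mingroupp minL.
have minLP := (mingroupP minL).2.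
have cLL : abelian L := abelem_abelian abL.
have nQL : Q \subset 'N(L).
  by apply: subset_trans nLG; rewrite -defG mulG_subr.
have powL x : x \in Q -> exists a, {in L, forall n, n ^ x = n ^+ a}.
  move=> Qx; have nLx : x \in 'N(L) := subsetP nQL x Qx.
  have [n [Ln ntn [a nxa]]] := eigenvector_exp abL ntL nLx (cQp x Qx).
  exists a; pose K := [set m in L | m ^ x == m ^+ a].
  have gK : group_set K.
    apply/group_setP; split=> [|m1 m2]; first by rewrite inE group1 conj1g expg1n eqxx.
    rewrite !inE => /andP[Lm1 /eqP e1] /andP[Lm2 /eqP e2].
    rewrite groupM //= conjMg e1 e2 expgMn //.
    exact: (centsP cLL).
  have defL : K = L.
    apply: (minLP (Group gK)); last by apply/subsetP=> m /=; rewrite inE => /andP[].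
    apply/andP; split.
      by apply/trivgPn; exists n; rewrite //= inE Ln nxa eqxx.
    rewrite -defG mul_subG //=.
      apply/subsetP=> c Cc; rewrite inE; apply/subsetP=> _ /imsetP[m Km ->].
      have Lm : m \in L by move: Km; rewrite inE => /andP[].
      by rewrite conjgE -(centP (subsetP cCL c Cc)) // mulKg.
    apply/subsetP=> y Qy; rewrite inE; apply/subsetP=> _ /imsetP[m Km ->].
    move: Km; rewrite !inE => /andP[Lm /eqP emx].
    have nLy : y \in 'N(L) := subsetP nQL y Qy.
    rewrite memJ_norm // Lm -conjXg -emx -!conjgM [x * y]commgC [eqbRHS]conjgM.
    have Lmyx : m ^ (y * x) \in L by rewrite memJ_norm // groupM.
    by rewrite [eqbRHS]conjgE -(centP (cQQ x y Qx Qy)) // mulKg eqxx.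
  by move=> m; rewrite -defL inE => /andP[_ /eqP].
have [n Ln ntn] := trivgPn _ ntL.
have defL : <[n]> = L.
  apply: minLP; last by rewrite cycle_subG.
  rewrite /= cycle_eq1 ntn -defG mul_subG //=.
    apply/subsetP=> c Cc; rewrite inE -cycleJ cycle_subG.
    by rewrite conjgE -(centP (subsetP cCL c Cc)) // mulKg cycle_id.
  apply/subsetP=> x Qx; rewrite inE -cycleJ cycle_subG.
  by have [a ->] := powL x Qx; rewrite // mem_cycle.
by rewrite -defL; apply: abelem_order_p abL Ln ntn.
Qed.

Lemma prime_order_aut p (X : {group gT}) :
  #|X| = p -> prime p ->
  {in 'N(X) &, forall x y, [~ x, y] \in 'C(X)}
   /\ {in 'N(X), forall x, x ^+ p.-1 \in 'C(X)}.
Proof.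
move=> oX p_pr; have : prime #|X| by rewrite oX.
move/prime_cyclic/cyclicP=> [v defX].
have ov : #[v] = p by rewrite -oX defX.
have powX x : x \in 'N(X) -> exists a, v ^ x = v ^+ a.
  by move=> nXx; apply/cycleP; rewrite -defX memJ_norm // defX cycle_id.
have centX b : v ^ b = v -> b \in 'C(X).
  by move=> vb; rewrite defX cent_cycle; apply/cent1P; rewrite /commute [RHS]conjgC vb.
have cNN y z : y \in 'N(X) -> z \in 'N(X) -> v ^ (y * z) = v ^ (z * y).
  move=> /powX[a va] /powX[b vb].
  by rewrite !conjgM va vb !conjXg va vb -!expgM mulnC.
split=> [x y nXx nXy | x nXx]; apply: centX.
  (* The images of [v] under [x * y] and [y * x] agree for all [x] and [y], so
     write the commutator with a single inverted product. *)
  have -> : [~ x, y] = (x^-1 * y^-1) * (y^-1 * x^-1)^-1.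
    by rewrite invMg !invgK !mulgA commgEl conjgE !mulgA.
  by rewrite conjgM cNN ?groupV // conjgK.
have [a va] := powX x nXx.
have vX k : v ^ (x ^+ k) = v ^+ (a ^ k).
  elim: k => [|k IHk]; first by rewrite conjg1.
  by rewrite expgSr conjgM IHk conjXg va -expgM expnS.
(* Fermat's little theorem in the form [a ^ p = a] avoids inverting [a]. *)
have -> : x ^+ p.-1 = x ^+ p * x^-1.
  by rewrite -{2}(prednK (prime_gt0 p_pr)) expgSr mulgK.
rewrite conjgM vX; apply: (canLR (conjgK x)); rewrite va.
by apply/eqP; rewrite eq_expg_mod_order ov; apply/eqP/fermat_little.
Qed.

End PowerAction.

Section MinimalNormal.

Variable gT : finGroupType.
Implicit Types G L N M K P T : {group gT}.

Lemma minnormal_sub_or_TI G L N :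
  minnormal L G -> G \subset 'N(N) -> L :&: N != 1 -> L \subset N.
Proof.
move=> minL nNG ntLN; have /andP[_ nLG] := mingroupp minL.
apply/setIidPl; apply: (mingroupP minL).2 => /=; last exact: subsetIl.
by rewrite ntLN normsI.
Qed.

Lemma minnormal_quotient_TI G L K :
  minnormal L G -> L \subset G -> K <| G -> L :&: K = 1 ->
  minnormal (L / K) (G / K) /\ #|L / K| = #|L|.
Proof.
move=> minL sLG nsKG tiLK; have nKG := normal_norm nsKG.
have /andP[ntL nLG] := mingroupp minL.
have nKL := subset_trans sLG nKG.
have oL : #|L / K| = #|L|.
  by rewrite card_quotient // -indexgI tiLK indexg1.
split=> //; apply/mingroupP; split=> [|Hb /andP[ntH nHG] sHL].
  by rewrite quotient_norms // andbT trivg_card1 oL -trivg_card1.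
have sLH : L \subset coset K @*^-1 Hb.
  apply: (@minnormal_sub_or_TI G L (coset K @*^-1 Hb)%G) => //.
    exact: norm_quotient_pre.
  have [hb Hhb nthb] := trivgPn _ ntH.
  have /morphimP[l nKl Ll defh] := subsetP sHL hb Hhb.
  apply/trivgPn; exists l; first by rewrite inE Ll mem_morphpre // -defh.
  by apply: contra nthb => /eqP l1; rewrite defh l1 morph1.
by apply/eqP; rewrite eqEsubset sHL sub_quotient_pre.
Qed.

(** For a maximal [M] containing [K] the intersection [L :&: M] is normalised
    by [M] and by the abelian [L], hence trivial by minimality. *)
Lemma minnormal_complement_maximal G L K :
    minnormal L G -> abelian L -> L \subset G -> K \subset G -> L * K = G ->
    L :&: K = 1 ->
  exists2 M : {group gT}, maximal M G & #|G : M| = #|L|.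
Proof.
move=> minL cLL sLG sKG defG tiLK.
have /andP[ntL nLG] := mingroupp minL.
have nsLG : L <| G by apply/andP.
have [eqKG | [M maxM sKM]] := maximal_exists sKG.
  by case/eqP: ntL; apply/trivgP; rewrite -tiLK subsetI subxx eqKG.
have sMG := maximal_sub maxM.
have nsLM : ~~ (L \subset M).
  apply/negP=> sLM; have := maxgroupp maxM; rewrite properE -{2}defG.
  by rewrite mul_subG ?andbF.
exists M => //; rewrite (index_maximal nsLG maxM nsLM).
have -> : L :&: M = 1; last by rewrite indexg1.
apply/eqP; apply: contraR (nsLM) => ntLM.
suff nLMG : G \subset 'N(L :&: M).
  have: L \subset L :&: M; last by rewrite subsetI => /andP[].
  by apply: (minnormal_sub_or_TI minL nLMG); rewrite /= setIA setIid.
rewrite -(normal_mul_maximal nsLG maxM nsLM) mul_subG //.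
  by rewrite normsI ?normG // (subset_trans sMG).
by rewrite cents_norm // centsC (subset_trans (subsetIl _ _)).
Qed.

(** Going down from [P] to [L] along a chief series of [G], coprime action lifts
    the fixed points of [b] from each chief layer, so that [P] is at every
    stage the product of the current term and of the centraliser of [b]. *)
Lemma cent_chief_layers G P L b :
    P <| G -> solvable P -> b \in G -> coprime #|P| #[b] ->
    L <| G -> L \subset P ->
    (forall T (X : {group coset_of T}), T <| G -> L \subset T ->
       minnormal X (G / T) -> X \subset P / T -> coset T b \in 'C(X)) ->
  L * 'C_P(<[b]>) = P.
Proof.
move=> nsPG solP Gb coPb nsLG sLP cbX; have sPG := normal_sub nsPG.
suff defP T : T <| G -> L \subset T -> T \subset P -> T * 'C_P(<[b]>) = P.
  exact: defP.
have [m] := ubnP (#|P| - #|T|).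
elim: m T => // m IHm T lePTm nsTG sLT sTP.
have [-> | neqTP] := eqVneq T P; first by rewrite mulGSid ?subsetIl.
have ltTP : T \proper P by rewrite properEneq neqTP.
have nsTP := normalS sTP sPG nsTG.
have ntPT : P / T != 1.
  by rewrite -subG1 quotient_sub1 ?normal_norm // proper_subn.
have nPTG : G / T \subset 'N(P / T) by rewrite quotient_norms ?normal_norm.
have [X minX sXP] := minnormal_exists ntPT nPTG.
have /andP[ntX nXG] := mingroupp minX.
pose K := (coset T @*^-1 X)%G.
have nsTK : T <| K by apply: normal_cosetpre.
have sKP : K \subset P by rewrite sub_cosetpre_quo.
have nsKG : K <| G.
  apply/andP; split; first exact: subset_trans sKP sPG.
  exact: norm_quotient_pre (normal_norm nsTG) nXG.
have defX : K / T = X by apply: cosetpreK.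
have ltTK : #|T| < #|K|.
  apply: proper_card; rewrite properE normal_sub //=.
  by rewrite -(quotient_sub1 (normal_norm nsTK)) [K / T]defX subG1.
have nTb : <[b]> \subset 'N(T) by rewrite cycle_subG (subsetP (normal_norm nsTG)).
have nKb : <[b]> \subset 'N(K) by rewrite cycle_subG (subsetP (normal_norm nsKG)).
have cKb : 'C_K(<[b]>) / T = K / T.
  rewrite coprime_norm_quotient_cent ?(coprimeSg sTP) ?(solvableS sTP) //.
  apply/setIidPl; rewrite centsC quotient_cycle; last by rewrite -cycle_subG.
  by rewrite cycle_subG [K / T]defX cbX.
have defK : T * 'C_K(<[b]>) = K.
  have nTC : 'C_K(<[b]>) \subset 'N(T).
    exact: subset_trans (subsetIl _ _) (normal_norm nsTK).
  by rewrite -quotientK // cKb quotientGK.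
rewrite -[RHS](IHm K) //; last exact: subset_trans sLT (normal_sub nsTK).
  by rewrite -[in RHS]defK -mulgA [in RHS]mulSGid ?setSI.
by apply: leq_trans (ltnSE lePTm); exact: ltn_sub2l (proper_card ltTP) ltTK.
Qed.

End MinimalNormal.

(** Let [P] be the normal Sylow subgroup for the largest prime [p].  A nontrivial
    normal [K] meeting [L] trivially lets one pass to [G / K], where [L] embeds as
    a minimal normal subgroup; so assume that [L] lies in [P] and, when the
    Frattini subgroup of [P] is nontrivial, in that subgroup.
    - If [P] is elementary abelian, then [L] has a complement in [P], hence in
      [G] by Gaschutz, and the index of this complement is that of a
      maximal subgroup.
    - Otherwise let [Q] be a complement of [P].  By induction the chief
      factors of [G] between [L] and [P] have order [p], so the commutators and
      the [p - 1]st powers of elements of [Q] centralise them; by coprime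
      action they centralise [P] modulo [L], hence modulo the Frattini
      subgroup, hence [P].  Since [L] is central in [P], the group [G] acts on
      [L] through an abelian group of exponent dividing [p - 1], and such an
      irreducible action over the field with [p] elements has degree one. *)
Lemma prime_index_minnormal_prime (gT : finGroupType) (G L : {group gT}) :
    (forall M : {group gT}, maximal M G -> prime #|G : M|) ->
  minnormal L G -> L \subset G -> prime #|L|.
Proof.
have [n] := ubnP #|G|.
elim: n gT G L => // n IHn gT G L /ltnSE-leGn primeG minL sLG.
have /andP[ntL nLG] := mingroupp minL.
have ntG : G :!=: 1 by apply: contra ntL => /eqP G1; rewrite -subG1 -G1.
have IHquo (K : {group gT}) (Lb : {group coset_of K}) :
    K <| G -> K :!=: 1 -> minnormal Lb (G / K) -> Lb \subset G / K -> prime #|Lb|.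
  move=> nsKG ntK; apply: IHn; last exact: prime_index_quotient.
  by rewrite (leq_trans _ leGn) // ltn_quotient ?normal_sub.
have IHti (K : {group gT}) : K <| G -> K :!=: 1 -> L :&: K = 1 -> prime #|L|.
  move=> nsKG ntK tiLK; have [minLb <-] := minnormal_quotient_TI minL sLG nsKG tiLK.
  by apply: IHquo minLb _ => //; apply: quotientS.
pose p := max_pdiv #|G|; have p_pr : prime p by rewrite max_pdiv_prime // cardG_gt1.
have [P sylP] := Sylow_exists p G; have nsPG := prime_index_Sylow_normal primeG sylP.
have [sPG pP _] := and3P sylP.
have ntP : P :!=: 1.
  rewrite -cardG_gt1 (card_Hall sylP) p_part_gt1 mem_primes p_pr cardG_gt0.
  exact: max_pdiv_dvd.
have [tiLP | ntLP] := eqVneq (L :&: P) 1; first exact: IHti tiLP.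
have sLP := minnormal_sub_or_TI minL (normal_norm nsPG) ntLP.
have solP := pgroup_sol pP; have pL := pgroupS sLP pP.
have abL : p.-abelem L.
  by rewrite -is_abelem_pgroup //; have [] := minnormal_solvable minL sLP solP.
have cLL := abelem_abelian abL.
have nsPhiG : 'Phi(P) <| G by apply: char_normal_trans (Phi_char P) nsPG.
have [tiLPhi | ntLPhi] := eqVneq (L :&: 'Phi(P)) 1.
  have [Phi1 | ntPhi] := eqVneq 'Phi(P) 1; last exact: IHti tiLPhi.
  have abP : p.-abelem P by rewrite -trivg_Phi // Phi1.
  have nsLG : L <| G by apply/andP.
  have coL : coprime #|L| #|G : P|.
    by apply: pnat_coprime pL _; case/and3P: sylP.
  have : [splits G, over L].
    by rewrite (Gaschutz_split nsLG sLP sPG cLL coL) (abelem_splits abP).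
  case/splitsP=> K /complP[tiLK defG].
  have sKG : K \subset G by rewrite -defG mulG_subr.
  have [M maxM <-] := minnormal_complement_maximal minL cLL sLG sKG defG tiLK.
  exact: primeG.
have sLPhi := minnormal_sub_or_TI minL (normal_norm nsPhiG) ntLPhi.
have /splitsP[Q /complP[tiPQ defG]] := SchurZassenhaus_split (pHall_Hall sylP) nsPG.
have sQG : Q \subset G by rewrite -defG mulG_subr.
have coPQ : coprime #|P| #|Q|.
  have -> : #|Q| = #|G : P|.
    by rewrite -divgS // -defG TI_cardMg // mulKn.
  by apply: pnat_coprime pP _; case/and3P: sylP.
have ntT (T : {group gT}) : L \subset T -> T :!=: 1.
  by move=> sLT; apply: contra ntL => /eqP T1; rewrite -subG1 -T1.
have cQP b x y : b \in Q ->
    x \in Q -> y \in Q -> b = [~ x, y] \/ b = x ^+ p.-1 -> b \in 'C(L).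
  move=> Qb Qx Qy defb; have Gb := subsetP sQG b Qb.
  suff defP : L * 'C_P(<[b]>) = P.
    have genP : 'Phi(P) <*> 'C_P(<[b]>) = P.
      apply/eqP; rewrite eqEsubset join_subG Phi_sub subsetIl /= -{1}defP.
      by rewrite mul_subG ?joing_subr // (subset_trans sLPhi) ?joing_subl.
    have := Phi_nongen genP; rewrite genGid => /setIidPl.
    by rewrite centsC cycle_subG; apply: (subsetP (centS sLP)).
  apply: (cent_chief_layers nsPG solP Gb) => //.
  - by apply: coprimegS coPQ; rewrite cycle_subG.
  - by apply/andP.
  move=> T X nsTG sLT minX sXP; have [_ nTG] := andP nsTG.
  have [ntX nXG] := andP (mingroupp minX).
  have prX : prime #|X|.
    by apply: IHquo minX (subset_trans sXP (quotientS T sPG)); rewrite ?ntT.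
  have pX : p.-group X := pgroupS sXP (quotient_pgroup _ pP).
  have oX : #|X| = p.
    have [_ pdvX _] := pgroup_pdiv pX ntX.
    by apply/esym/eqP; rewrite -dvdn_prime2.
  have nTQ z : z \in Q -> z \in 'N(T) by move/(subsetP sQG)/(subsetP nTG).
  have nXQ z : z \in Q -> coset T z \in 'N(X).
    by move/(subsetP sQG)=> Gz; apply/(subsetP nXG)/mem_quotient.
  have [cX eX] := prime_order_aut oX p_pr.
  case: defb => ->; rewrite ?morphR ?morphX ?nTQ //; [apply: cX | apply: eX];
    exact: nXQ.
have cPL : P \subset 'C(L).
  have nsLP : L <| P by rewrite /normal sLP (subset_trans sPG).
  have ntLZ := meet_center_nil (pgroup_nil pP) nsLP ntL.
  have nsZG : 'Z(P) <| G by apply: char_normal_trans (center_char P) nsPG.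
  have := minnormal_sub_or_TI minL (normal_norm nsZG) ntLZ.
  by rewrite subsetI centsC => /andP[].
have -> : #|L| = p; last exact: p_pr.
apply: minnormal_power_prime minL abL defG cPL _ _ => [x y Qx Qy | x Qx].
  by apply: (cQP _ x y); rewrite ?groupR //; left.
by apply: (cQP _ x x); rewrite ?groupX //; right.
Qed.

Lemma prime_index_supersolvable (gT : finGroupType) (G : {group gT}) :
  (forall M : {group gT}, maximal M G -> prime #|G : M|) -> supersolvable G.
Proof.
move=> primeG; have [s path_s last_s] := chief_series_exists (normal_refl G).
exists s; last by rewrite last_s.
have : 1%G <| G by apply: normal1.
elim: s 1%G path_s {last_s} => //= B s IHs A /andP[chAB path_s] nsAG.
have /andP[maxAB nsBG] := chAB; rewrite IHs // andbT.
have sAB := maxnormal_sub maxAB.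
apply/and4P; split=> //; apply: prime_cyclic.
apply: (@prime_index_minnormal_prime _ (G / A)).
- exact: prime_index_quotient.
- exact: chief_factor_minnormal.
- by rewrite quotientS ?normal_sub.
Qed.
(** * Invariants determined by the maximal subgroups *)

(** All that the graphs retain of the multiplication: [f] need not be a morphism,
    nor even preserve the identity. *)
Definition maximal_bijection (gT hT : finGroupType) (G : {group gT})
    (H : {group hT}) (f : gT -> hT) : Prop :=
  [/\ {in G &, injective f},
      f @: G = H,
      forall M : {group gT}, maximal M G ->
        exists2 K : {group hT}, maximal K H & f @: M = K
    & forall K : {group hT}, maximal K H ->
        exists2 M : {group gT}, maximal M G & f @: M = K].

Section Transfer.

Variables (gT hT : finGroupType) (G : {group gT}) (H : {group hT}) (f : gT -> hT).
Hypothesis maxf : maximal_bijection G H f.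
Implicit Types (M N L : {group gT}) (K : {group hT}).

Let injf : {in G &, injective f}. Proof. by case: maxf. Qed.
Let imf : f @: G = H. Proof. by case: maxf. Qed.

Lemma maximal_bijection_card : #|G| = #|H|.
Proof. by rewrite -imf (card_imset_in injf). Qed.

Lemma maximal_bijection_index M K : maximal M G -> f @: M = K -> #|G : M| = #|H : K|.
Proof.
case: maxf => _ _ toH _ maxM defK; have sMG := maximal_sub maxM.
have sKH : K \subset H by rewrite -defK -imf (imsetS_in injf).
by rewrite -!divgS // -defK (card_imset_in injf) // maximal_bijection_card.
Qed.

Lemma maximal_bijection_factorise M1 M2 K1 K2 :
    maximal M1 G -> maximal M2 G -> f @: M1 = K1 -> f @: M2 = K2 ->
  factorise G M1 M2 = factorise H K1 K2.
Proof.
move=> /maximal_sub sM1G /maximal_sub sM2G defK1 defK2.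
rewrite /factorise -maximal_bijection_card -defK1 -defK2 -(imsetI_in injf) //.
rewrite !(card_imset_in injf) //.
by rewrite subIset // sM1G.
Qed.

Lemma maximal_bijection_grank : 'm(H) <= 'm(G).
Proof.
have [B genB <-] := grank_witness G.
have sBG : B \subset G by rewrite -genB subset_gen.
rewrite -(card_imset_in injf sBG); suff <- : <<f @: B>> = H by apply: grank_min.
have sfBH : <<f @: B>> \subset H by rewrite gen_subG -imf (imsetS_in injf).
have [// | [K maxK]] := maximal_exists sfBH; rewrite gen_subG.
case: maxf => _ _ _ /(_ K maxK)[M maxM <-]; rewrite (imsetS_in injf) ?maximal_sub //.
by rewrite -gen_subG genB; have := maxgroupp maxM; rewrite properE => /andP[_ /negPf->].
Qed.

Lemma maximal_bijection_Phi : #|'Phi(G)| <= #|'Phi(H)|.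
Proof.
rewrite -(card_imset_in injf (Phi_sub G)); apply: subset_leq_card.
apply/bigcapsP=> K /predU1P[-> | maxK]; first by rewrite -imf (imsetS_in injf) ?Phi_sub.
case: maxf => _ _ _ /(_ K maxK)[M maxM <-].
rewrite (imsetS_in injf (Phi_sub G) (maximal_sub maxM)); exact: Phi_sub_max.
Qed.

Lemma maximal_bijection_nilpotent : nilpotent G -> nilpotent H.
Proof.
move=> nilG; apply: factorise_nilpotent => K1 K2 maxK1 maxK2 neqK.
case: maxf => _ _ _ toG.
have [[M1 maxM1 defK1] [M2 maxM2 defK2]] := (toG K1 maxK1, toG K2 maxK2).
rewrite -(maximal_bijection_factorise maxM1 maxM2 defK1 defK2).
apply: nilpotent_factorise => //; apply: contra neqK => /eqP eqM.
by rewrite -defK1 eqM defK2.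
Qed.

Lemma maximal_bijection_supersolvable : supersolvable G -> supersolvable H.
Proof.
move=> ssG; apply: prime_index_supersolvable => K maxK.
case: maxf => _ _ _ /(_ K maxK)[M maxM defK].
by rewrite -(maximal_bijection_index maxM defK) supersolvable_prime_index.
Qed.

(** The counterpart of [N] in [H], as far as maximal subgroups can tell: it is the
    Frattini subgroup of [H] for [N] trivial, and [H] itself for [N = G]. *)
Definition max_hull N : {group hT} :=
  [group of H :&: \bigcap_(K : {group hT} | maximal K H && (f @: N \subset K)) K].

Lemma max_hull_sub N K : maximal K H -> N \subset G ->
  (max_hull N \subset K) = (f @: N \subset K).
Proof.
move=> maxK sNG; apply/idP/idP => [|sNK].
  apply: subset_trans; rewrite subsetI -{1}imf (imsetS_in injf) // sNG.
  by apply/bigcapsP=> K' /andP[].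
by apply/subIset/orP; right; apply: bigcap_inf; rewrite maxK.
Qed.

(** If [N] lies in [M] but not in [M2], then [M * M2] contains [N * M2 = G].  So a
    conjugate of the image of [M], with which this image does not factorise
    [H], is again the image of a maximal subgroup containing [N]. *)
Lemma max_hull_normal N : N <| G -> max_hull N <| H.
Proof.
move=> nsNG; rewrite /normal subsetIl /=; apply/subsetP=> h Hh; rewrite inE.
rewrite conjIg conjGid //; apply/subsetP=> y; rewrite inE => /andP[Hy].
rewrite mem_conjg => /bigcapP y_in; rewrite inE Hy /=; apply/bigcapP=> K /andP[maxK sNK].
have Hh' : h^-1 \in H by rewrite groupV.
have maxKh : maximal (K :^ h^-1) H by rewrite -(conjGid Hh') maximalJ.
suff sNKh : f @: N \subset K :^ h^-1.
  have := y_in (K :^ h^-1)%G; rewrite maxKh sNKh => /(_ isT).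
  by rewrite memJ_conjg.
case: maxf => _ _ _ toG.
have [[M maxM defK] [M2 maxM2 defKh]] := (toG K maxK, toG _ maxKh).
have [[sMG sM2G] sNG] := (maximal_sub maxM, maximal_sub maxM2, normal_sub nsNG).
rewrite -defK (imsetS_in injf) // in sNK; rewrite /= -defKh (imsetS_in injf) //.
apply/idPn=> nsNM2; have defG := normal_mul_maximal nsNG maxM2 nsNM2.
have : factorise G M M2.
  rewrite /factorise mulnC setIC; apply/(factoriseP sM2G sMG)/eqP.
  by rewrite eqEsubset mul_subG // -{1}defG mulgS.
rewrite (maximal_bijection_factorise maxM maxM2 defK defKh).
move/(factoriseP (maximal_sub maxK) (maximal_sub maxKh))/(mulg_conj_eq Hh') => Kh.
by case/negP: nsNM2; rewrite -(imsetS_in injf sNG sM2G) defKh /= conjGid // -defK (imsetS_in injf).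
Qed.

(** Descending induction along a chief series of [G]: a maximal subgroup which
    contains [N] and not [L], with [L / N] a chief factor of the soluble group
    [G], has as index a divisor of the prime power [#|L / N|]. *)
Lemma max_hull_sol N : solvable G -> N <| G -> solvable (H / max_hull N).
Proof.
move=> solG; have [n] := ubnP (#|G| - #|N|); elim: n N => // n IHn N /ltnSE-leGN nsNG.
have nsDH := max_hull_normal nsNG.
have [eqNG | neqNG] := eqVneq N G.
  suff -> : max_hull N :=: H by rewrite trivg_quotient solvable1.
  apply/eqP; rewrite eqEsubset subsetIl subsetI subxx /=; apply/bigcapsP=> K.
  by rewrite eqNG imf => /andP[].
have [sNG nNG] := andP nsNG.
have ltNG : N \proper G by rewrite properEneq neqNG.
have ntGN : G / N != 1 by rewrite -subG1 quotient_sub1 // proper_subn.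
have [X minX sXG] := minnormal_exists ntGN (normG _).
have solGN := quotient_sol N solG.
have [_ ntX abX] := minnormal_solvable minX sXG solGN.
have [_ nXG] := andP (mingroupp minX).
pose L := (coset N @*^-1 X)%G.
have defX : L / N = X by apply: cosetpreK.
have nsNL : N <| L by apply: normal_cosetpre.
have nsLG : L <| G.
  by rewrite /normal sub_cosetpre_quo // sXG norm_quotient_pre.
have nsDLH := max_hull_normal nsLG.
have sD : max_hull N \subset max_hull L.
  rewrite subsetI subsetIl; apply/bigcapsP=> K /andP[maxK sLK].
  rewrite max_hull_sub //; apply: subset_trans sLK; exact/imsetS/normal_sub.
have ltNL : #|N| < #|L|.
  apply: proper_card; rewrite properE normal_sub //=.
  by rewrite -(quotient_sub1 (normal_norm nsNL)) [L / N]defX subG1.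
have solL : solvable (H / max_hull L).
  apply: IHn nsLG; apply: leq_trans leGN.
  exact: ltn_sub2l (proper_card ltNG) ltNL.
have nsq := quotient_normal (max_hull N) nsDLH.
rewrite (series_sol nsq) (isog_sol (third_isog sD nsDH nsDLH)) solL andbT.
apply: (@p_power_maximals_quo_sol _ (pdiv #|X|) H (max_hull N) (max_hull L)) => // K maxK.
have [sLG sNL] := (normal_sub nsLG, normal_sub nsNL).
rewrite (max_hull_sub maxK sNG) (max_hull_sub maxK sLG).
case: maxf => _ _ _ /(_ K maxK)[M maxM defK].
have sMG := maximal_sub maxM.
rewrite -(maximal_bijection_index maxM defK) -defK !(imsetS_in injf) // => sNM nsLM.
rewrite (index_maximal nsLG maxM nsLM).
apply: (@pnat_dvd _ #|L : N|); first by rewrite indexgS // subsetI sNL.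
rewrite -card_quotient ?normal_norm // [L / N]defX; exact: abelem_pgroup abX.
Qed.

Lemma maximal_bijection_solvable : solvable G -> solvable H.
Proof.
move=> solG; have ns1 := normal1 G.
rewrite (series_sol (max_hull_normal ns1)) max_hull_sol // andbT.
apply: solvableS (nilpotent_sol (Phi_nilpotent H)).
apply: sub_Phi; first exact: subsetIl.
move=> K maxK; rewrite max_hull_sub ?sub1G //.
by case: maxf => _ _ _ /(_ K maxK)[M maxM <-]; rewrite (imsetS_in injf) ?sub1G ?maximal_sub.
Qed.

End Transfer.

(** * The Dirichlet polynomial *)

Section Crosscut.

Import GRing.Theory.
Local Open Scope ring_scope.

(** Expand the product over [I] of [F i + 1], where [F] is -1 on [A] and 0
    elsewhere. *)
Lemma sum_sign_subsets (I : finType) (A : {set I}) :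
  \sum_(S : {set I} | S \subset A) (-1) ^+ #|S| = (A == set0)%:R :> int.
Proof.
pose F i : int := if i \in A then -1 else 0.
have distr : \prod_i (F i + 1) = \sum_(S : {set I}) \prod_i (if i \in S then F i else 1).
  by rewrite bigA_distr.
transitivity (\prod_i (F i + 1)); last first.
  have [A0 | [a Aa]] := set_0Vmem A.
    by rewrite A0 eqxx big1 // => i _; rewrite /F A0 inE add0r.
  rewrite (bigD1 a) //= /F Aa addNr mul0r; case: eqP => // A0.
  by rewrite A0 inE in Aa.
rewrite distr big_mkcond /=; apply: eq_bigr => S _.
rewrite -big_mkcond /=; case: ifPn => [sSA | ].
  rewrite -prodr_const; apply: eq_bigr => i Si.
  by rewrite /F (subsetP sSA).
by case/subsetPn=> i Si nAi; rewrite (bigD1 i) //= /F (negPf nAi) mul0r.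
Qed.

Variable gT : finGroupType.
Implicit Types (G K M : {group gT}) (S : {set {group gT}}).

Definition maximals G : {set {group gT}} := [set M : {group gT} | maximal M G].

Definition meet G S : {group gT} := [group of G :&: \bigcap_(M in S) M]%g.

(** Summing the right-hand side over all [K] between [K'] and [G] gives the signed
    count of all sets of maximal subgroups containing [K'], which is 1 if there
    is no such maximal subgroup, that is if [K' = G], and 0 otherwise: the
    right-hand side satisfies the recursion which defines the Moebius
    function. *)
Lemma moebius_crosscut G K : K \subset G ->
  moebius G K =
    \sum_(S : {set {group gT}} | (S \subset maximals G) && (meet G S == K))
       (-1) ^+ #|S|.
Proof.
pose nu (K1 : {group gT}) : int :=
  \sum_(S : {set {group gT}} | (S \subset maximals G) && (meet G S == K1))
     (-1) ^+ #|S|.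
rewrite -/(nu K).
have nu_sum K' : K' \subset G ->
  \sum_(K2 : {group gT} | (K' \subset K2) && (K2 \subset G)) nu K2 = (K' == G)%:R.
  move=> sKG; rewrite /nu; pose A := [set M in maximals G | K' \subset M].
  have -> : (K' == G)%:R = (A == set0)%:R :> int.
    congr (nat_of_bool _)%:R; apply/eqP/eqP => [eqKG | A0].
      apply/setP=> M; rewrite !inE; apply/negP=> /andP[/maxgroupp].
      by rewrite eqKG properE => /andP[_ /negPf->].
    apply: val_inj; have [//= | [M maxM sKM]] := maximal_exists sKG.
    by have: M \in A by [rewrite !inE maxM]; rewrite A0 inE.
  rewrite -sum_sign_subsets.
  rewrite (exchange_big_dep (fun S => S \subset maximals G)) /=; last first.
    by move=> K2 S _ /andP[].
  rewrite [RHS](eq_bigl (fun S => (S \subset maximals G) && (K' \subset meet G S))).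
    rewrite [RHS]big_mkcondr; apply: eq_bigr => S sSM.
    have [sKS | nsKS] := ifPn.
      rewrite (big_pred1 (meet G S)) // => K2 /=.
      by apply/andP/eqP => [[_ /andP[_ /eqP]] | ->]; rewrite ?sKS ?subsetIl ?sSM ?eqxx.
    rewrite big1 // => K2 /andP[/andP[sK2 _] /andP[_ /eqP eqK2]].
    by rewrite eqK2 sK2 in nsKS.
  move=> S; rewrite subsetI sKG /=; apply/idP/andP => [sSA | [sSM /bigcapsP sK]].
    split; first by apply/subsetP=> M /(subsetP sSA); rewrite inE => /andP[].
    by apply/bigcapsP=> M /(subsetP sSA); rewrite inE => /andP[].
  by apply/subsetP=> M SM; rewrite inE (subsetP sSM) // sK.
have [n] := ubnP (#|G| - #|K|)%N; elim: n K => // n IHn K /ltnSE-leGK sKG.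
have := moebius_sum sKG; rewrite -(nu_sum K sKG).
rewrite (bigD1 K) ?subxx //= [RHS](bigD1 K) ?subxx //=.
set s1 := (X in _ + X = _); set s2 := (X in _ = _ + X).
suff -> : s1 = s2 by move/addIr.
apply: eq_bigr => K2 /andP[/andP[sK sK2] neqK]; apply: IHn => //.
have ltK : (#|K| < #|K2|)%N by rewrite proper_card // properEneq eq_sym neqK.
apply: leq_trans leGK; apply: ltn_sub2l => //.
exact: leq_trans ltK (subset_leq_card sK2).
Qed.

Lemma dirichlet_crosscut G n :
  dirichlet_coef G n =
    \sum_(S : {set {group gT}} |
             (S \subset maximals G) && (#|G : meet G S|%g == n))
       (-1) ^+ #|S|.
Proof.
rewrite /dirichlet_coef.
rewrite (eq_bigr _ (fun K H => moebius_crosscut (proj1 (andP H)))).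
pose Q S := (S \subset maximals G) && (#|G : meet G S|%g == n).
rewrite (exchange_big_dep Q) /=; last first.
  move=> K S /andP[_ iK] /andP[sSM /eqP eqK]; rewrite -eqK in iK.
  by rewrite /Q sSM.
apply: eq_bigr => S /andP[sSM iS]; rewrite (big_pred1 (meet G S)) // => K /=.
rewrite sSM /=; apply/andP/eqP => [[_ /eqP] // | ->].
by rewrite subsetIl eqxx; split=> //; exact: iS.
Qed.

End Crosscut.

Section TransferDirichlet.

Import GRing.Theory.

Variables (gT hT : finGroupType) (G : {group gT}) (H : {group hT}) (f : gT -> hT).
Hypothesis maxf : maximal_bijection G H f.

Let injf : {in G &, injective f}. Proof. by case: maxf. Qed.

Let F (M : {group gT}) : {group hT} := [group of <<f @: M>>].

Let FE (M : {group gT}) : maximal M G -> F M = f @: M :> {set hT}.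
Proof. by case: maxf => _ _ toH _ /toH[K _ eqK]; rewrite /= eqK genGid. Qed.

Let maxF (M : {group gT}) : maximal M G -> maximal (F M) H.
Proof.
move=> maxM; case: maxf => _ _ /(_ M maxM)[K maxK eqK] _.
by rewrite FE // eqK.
Qed.

Let injF : {in maximals G &, injective F}.
Proof.
move=> M1 M2; rewrite !inE => maxM1 maxM2 /(congr1 val) /=; rewrite -!/(val (F _)) => eqF.
have [s1 s2] := (maximal_sub maxM1, maximal_sub maxM2).
have {}eqF : f @: M1 = f @: M2 by rewrite -!FE.
apply/val_inj/eqP.
rewrite /= eqEsubset -(imsetS_in injf s1 s2) -(imsetS_in injf s2 s1).
by rewrite eqF subxx.
Qed.

Let imF : F @: maximals G = maximals H.
Proof.
apply/setP=> K; apply/imsetP/idP => [[M] | ].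
  by rewrite !inE => maxM ->; apply: maxF.
rewrite inE => maxK; case: (maxf) => _ _ _ /(_ K maxK)[M maxM eqK].
by exists M; rewrite ?inE //; apply: val_inj; rewrite /= FE.
Qed.

Let meetF (S : {set {group gT}}) : S \subset maximals G ->
  #|H : meet H (F @: S)| = #|G : meet G S|.
Proof.
move=> /subsetP sSM.
have sMG M : M \in S -> maximal M G by move/sSM; rewrite inE.
have eqM : meet H (F @: S) = f @: meet G S :> {set hT}.
  have imf : f @: G = H by case: maxf.
  apply/setP=> y; apply/idP/imsetP => [/setIP[] | [x /setIP[Gx /bigcapP xS] ->]].
    rewrite -{1}imf => /imsetP[x Gx ->] /bigcapP yS; exists x => //.
    rewrite inE Gx; apply/bigcapP=> M SM.
    have := yS (F M) (imset_f F SM); rewrite FE ?sMG //.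
    by rewrite (mem_imset_in injf) // maximal_sub ?sMG.
  rewrite inE -{1}imf imset_f //=; apply/bigcapP=> _ /imsetP[M SM ->].
  by rewrite FE ?sMG // imset_f // xS.
rewrite -!divgS ?subsetIl // eqM (card_imset_in injf) ?subsetIl //.
by rewrite (maximal_bijection_card maxf).
Qed.

Lemma maximal_bijection_dirichlet n : dirichlet_coef G n = dirichlet_coef H n.
Proof.
rewrite !dirichlet_crosscut.
pose F' (T : {set {group hT}}) := [set M in maximals G | F M \in T].
have F'K (S : {set {group gT}}) : S \subset maximals G -> F' (F @: S) = S.
  move=> sSM; apply/setP=> M; rewrite inE; apply/andP/idP => [[maxM] | SM].
    case/imsetP=> M2 SM2 /injF eqM; rewrite eqM //.
    exact: (subsetP sSM).
  by rewrite (subsetP sSM) // imset_f.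
rewrite (reindex_onto (fun S : {set {group gT}} => F @: S) F') /=; last first.
  move=> T /andP[sTM _]; apply/setP=> K; apply/imsetP/idP => [[M] | TK].
    by rewrite inE => /andP[_ FM] ->.
  have := subsetP sTM K TK; rewrite -imF => /imsetP[M maxM eqK].
  by exists M; rewrite // inE maxM -eqK.
apply: eq_big => [S | S /andP[sSM _]].
  apply/andP/andP => [[sSM iS] | [/andP[_ iS] /eqP F'S]].
    by rewrite F'K // meetF // iS -imF imsetS.
  have sSM : S \subset maximals G.
    by rewrite -F'S; apply/subsetP=> M; rewrite inE => /andP[].
  by rewrite -meetF.
rewrite card_in_imset // => M1 M2 /(subsetP sSM) maxM1 /(subsetP sSM).
exact: injF.
Qed.

Lemma maximal_bijection_dirichlet_poly (R : realType) (s : R[i]) :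
  dirichlet_poly G s = dirichlet_poly H s.
Proof.
rewrite /dirichlet_poly (maximal_bijection_card maxf).
by apply: eq_bigr => n _; rewrite maximal_bijection_dirichlet.
Qed.

End TransferDirichlet.

(** * From the graphs to the maximal subgroups *)

Lemma lgraph_iso_sym (X Y : lgraph) : lgraph_iso X Y -> lgraph_iso Y X.
Proof.
case=> psi [psi' psiK psi'K] adj_psi; exists psi'; first by exists psi.
by move=> x y; rewrite -adj_psi !psi'K.
Qed.

Lemma lgraph_iso_trans (X Y Z : lgraph) :
  lgraph_iso X Y -> lgraph_iso Y Z -> lgraph_iso X Z.
Proof.
case=> f bij_f adj_f [g bij_g adj_g]; exists (g \o f); first exact: bij_comp.
by move=> x y; rewrite /= adj_g adj_f.
Qed.

Lemma induced_setT (X : lgraph) : lgraph_iso (induced [set: X]) X.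
Proof.
exists val => //; exists (fun x => Sub x (in_setT x)) => x; last by rewrite SubK.
by apply: val_inj; rewrite SubK.
Qed.

Lemma same_Lambda1_sym (gT hT : finGroupType) (G : {group gT}) (H : {group hT}) :
  same_Lambda1 G H -> same_Lambda1 H G.
Proof.
case=> phi [phi' phiK phi'K] iso_phi; exists phi'; first by exists phi.
by move=> j; apply: lgraph_iso_sym; rewrite -{2}(phi'K j).
Qed.

Section GammaStar.

Variables (gT : finGroupType) (G : {group gT}) (t : nat).
Local Notation Gm := (Gamma 1 t G).
Local Notation Gs := (Gamma_star 1 t G).
Implicit Types (w : seq gT).

Definition word (v : Gs) : seq gT := val (val (val v)).

Lemma word_inj : injective word.
Proof. by move=> u v eq_uv; do 3 apply: val_inj; exact: eq_uv. Qed.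

Lemma word_in v : all (mem G) (word v).
Proof. by have := valP (val v); rewrite inE => /andP[]. Qed.

Lemma size_word v : (size (word v) == 1%N) || (size (word v) == t).
Proof. by have := valP (val v); rewrite inE => /andP[]. Qed.

Lemma adj_word u v : adj u v = joint_generation 1 t G (word u) (word v).
Proof. by []. Qed.

Lemma Gamma_vertex w : all (mem G) w -> (size w == 1%N) || (size w == t) ->
  exists v : Gm, val (val v) = w :> seq gT.
Proof.
move=> wG sz_w; have le_w : size w <= maxn 1 t.
  by case/orP: sz_w => /eqP->; rewrite leq_max leqnn ?orbT.
have wV : Bseq le_w \in Gamma_vertices 1 t G by rewrite inE wG sz_w.
by exists (Sub (Bseq le_w) wV).
Qed.

Lemma joint_generation_size w w' : joint_generation 1 t G w w' ->
  (size w == 1%N) || (size w == t).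
Proof. by case/andP=> /orP[]/andP[-> _]; rewrite ?orbT. Qed.

Lemma word_surj w w' : all (mem G) w -> all (mem G) w' ->
  joint_generation 1 t G w w' -> exists v, word v = w.
Proof.
move=> wG w'G gen_ww'; have sz_w := joint_generation_size gen_ww'.
have sz_w' : (size w' == 1%N) || (size w' == t).
  by move: gen_ww'; rewrite joint_generationC; apply: joint_generation_size.
have [v eq_v] := Gamma_vertex wG sz_w; have [v' eq_v'] := Gamma_vertex w'G sz_w'.
have nv : v \in nonisolated Gm.
  by rewrite inE; apply/existsP; exists v'; rewrite /= /Gamma_adj eq_v eq_v'.
by exists (Sub v nv); rewrite /word SubK.
Qed.

End GammaStar.

Section Neighbourhoods.

Variables (gT : finGroupType) (G : {group gT}).
Implicit Types (w s : seq gT) (A B : {set gT}).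

(** The neighbourhood, among the elements of [G], of any tuple which generates the
    same subgroup as [A]. *)
Definition cogen A : {set gT} := [set x in G | <<x |: A>> == G].

Lemma joint_generation1 t x w : size w = t ->
  joint_generation 1 t G [:: x] w = (<<x |: [set z in w]>> == G).
Proof.
move=> sz_w; rewrite /joint_generation /= sz_w !eqxx /=.
by congr (<<_>> == _ :> {set gT}); apply/setP=> z; rewrite !inE.
Qed.

(** Appending copies of 1 brings a tuple to length [t] without changing the
    subgroup it generates. *)
Definition pad t s := s ++ nseq (t - size s) 1.

Lemma size_pad t s : size s <= t -> size (pad t s) = t.
Proof. by move=> le_s; rewrite size_cat size_nseq subnKC. Qed.

Lemma pad_in t s : all (mem G) s -> all (mem G) (pad t s).
Proof. by move=> sG; rewrite all_cat sG all_nseq /= group1 orbT. Qed.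

Lemma gen_pad t x s : <<x |: [set z in pad t s]>> = <<x |: [set z in s]>>.
Proof.
apply/eqP; rewrite eqEsubset !gen_subG; apply/andP; split; last first.
  apply: subset_trans (subset_gen _); apply/subsetP=> z.
  by rewrite !inE mem_cat => /orP[-> // | ->]; rewrite orbT.
apply/subsetP=> z; rewrite !inE mem_cat orbA => /orP[zs | ].
  by apply: mem_gen; rewrite !inE.
by rewrite mem_nseq => /andP[_ /eqP->]; apply: group1.
Qed.

Lemma cogen_maximal (M : {group gT}) : maximal M G -> cogen M = G :\: M.
Proof.
move=> maxM; have sMG := maximal_sub maxM; apply/setP=> x; rewrite !inE.
have [Gx | nGx] /= := boolP (x \in G); last by rewrite andbF.
rewrite andbT; apply/eqP/idP => [defG | nMx].
  apply/negP=> Mx; have := maxgroupp maxM; rewrite properE -{2}defG.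
  by rewrite gen_subG subUset sub1set Mx subxx andbF.
have sxMG : <<x |: M>> \subset G by rewrite gen_subG subUset sub1set Gx.
have [//|[K maxK]] := maximal_exists sxMG.
rewrite gen_subG subUset sub1set => /andP[Kx sMK].
by rewrite (maximal_eq_sub maxM maxK sMK) Kx in nMx.
Qed.

Lemma cogen_sub_maximal A : A \subset G -> cogen A != G ->
  exists2 M : {group gT}, maximal M G & cogen A \subset G :\: M.
Proof.
move=> sAG neqG; have sgAG : <<A>> \subset G by rewrite gen_subG.
have [defG | [M maxM sAM]] := maximal_exists sgAG.
  case/eqP: neqG; apply/setP=> x; rewrite inE; case Gx: (x \in G) => //=.
  apply/eqP/eqP; rewrite eqEsubset gen_subG subUset sub1set Gx sAG /=.
  by rewrite -{1}defG genS ?subsetUr.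
exists M => //; apply/subsetP=> x; rewrite !inE => /andP[Gx /eqP defG].
rewrite Gx andbT; apply/negP=> Mx; have := maxgroupp maxM; rewrite properE -{2}defG.
by rewrite gen_subG subUset sub1set Mx -(gen_subG A) sAM andbF.
Qed.

Lemma setD_maximal (M K : {group gT}) : maximal M G -> maximal K G ->
  G :\: M \subset G :\: K -> K :=: M.
Proof.
move=> maxM maxK sMK; apply: (maximal_eq_sub maxK maxM).
apply/subsetP=> x Kx; apply: contraLR (Kx) => nMx.
have Gx := subsetP (maximal_sub maxK) x Kx.
by have := subsetP sMK x; rewrite !inE nMx Gx !andbT => /(_ isT).
Qed.

Lemma maximal_cogen_ntriv (M : {group gT}) : maximal M G ->
  (cogen M != set0) /\ (cogen M != G).
Proof.
move=> maxM; rewrite cogen_maximal //; split.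
  by rewrite setD_eq0; have := maxgroupp maxM; rewrite properE => /andP[].
by apply/eqP=> /setP/(_ 1); rewrite !inE !group1.
Qed.

End Neighbourhoods.

(** The complements of the maximal subgroups are the maximal elements among the
    sets [cogen G A] other than [G], so they are recognised by a bijection which
    respects the families of nonempty sets of the form [cogen G A]. *)
Lemma cogen_bijection_maximal (gT hT : finGroupType) (G : {group gT})
    (H : {group hT}) (f : gT -> hT) :
    {in G &, injective f} -> f @: G = H ->
    (forall A : {set gT}, A \subset G -> cogen G A != set0 ->
       exists2 B : {set hT}, B \subset H & f @: cogen G A = cogen H B) ->
    (forall B : {set hT}, B \subset H -> cogen H B != set0 ->
       exists2 A : {set gT}, A \subset G & f @: cogen G A = cogen H B) ->
  maximal_bijection G H f.
Proof.
move=> injf imf toH toG.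
have sGG A : cogen G A \subset G by apply/subsetP=> x /setIdP[].
have neq_im A : (f @: cogen G A == H) = (cogen G A == G).
  by rewrite !eqEsubset -imf !(imsetS_in injf).
have imD (M : {group gT}) (K : {group hT}) : M \subset G -> K \subset H ->
    f @: (G :\: M) = H :\: K -> f @: M = K.
  move=> sMG sKH eqD; apply/setP=> y; apply/imsetP/idP => [[x Mx ->] | Ky].
    have Gx := subsetP sMG x Mx; apply/idPn=> nKy.
    have : f x \in H :\: K by rewrite inE nKy -imf imset_f.
    rewrite -eqD => /imsetP[z /setDP[Gz nMz]] /injf eq_xz.
    by rewrite -eq_xz ?Mx in nMz.
  have := subsetP sKH y Ky; rewrite -imf => /imsetP[x Gx def_y].
  exists x => //; apply: contraLR (Ky) => nMx.
  have : y \in f @: (G :\: M) by rewrite def_y imset_f // inE nMx.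
  by rewrite eqD => /setDP[].
have toG_max (K : {group hT}) : maximal K H ->
    exists2 M : {group gT}, maximal M G & f @: M = K /\ f @: cogen G M = H :\: K.
  move=> maxK; have [nt0 ntH] := maximal_cogen_ntriv maxK.
  have [A sAG defK] := toG K (maximal_sub maxK) nt0.
  rewrite -defK neq_im in ntH; have [M maxM sAM] := cogen_sub_maximal sAG ntH.
  rewrite -cogen_maximal // in sAM.
  have [ntM0 ntMG] := maximal_cogen_ntriv maxM.
  have [B sBH defB] := toH M (maximal_sub maxM) ntM0.
  have ntB : cogen H B != H by rewrite -defB neq_im.
  have [K' maxK' sBK'] := cogen_sub_maximal sBH ntB.
  rewrite cogen_maximal // in defK.
  have sK' : H :\: K \subset H :\: K'.
    by rewrite -defK; apply: subset_trans sBK'; rewrite -defB (imsetS_in injf).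
  have eqK' := setD_maximal maxK maxK' sK'; rewrite eqK' in sBK'.
  have defM : f @: cogen G M = H :\: K.
    by apply/eqP; rewrite eqEsubset {1}defB sBK' -defK (imsetS_in injf).
  exists M => //; split=> //; apply: imD; rewrite ?maximal_sub //.
  by rewrite -cogen_maximal.
split=> // [M maxM | K /toG_max[M maxM [eqK _]]]; last by exists M.
have [nt0 ntG] := maximal_cogen_ntriv maxM.
have [B sBH defB] := toH M (maximal_sub maxM) nt0.
have ntB : cogen H B != H by rewrite -defB neq_im.
have [K maxK sBK] := cogen_sub_maximal sBH ntB.
have [M' maxM' [eqK eqK']] := toG_max K maxK.
exists K => //; rewrite -eqK; congr (f @: _).
rewrite -defB -eqK' (imsetS_in injf) // !cogen_maximal // in sBK.
by rewrite (setD_maximal maxM maxM' sBK).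
Qed.

Section Connected.

Variables (gT : finGroupType) (G : {group gT}) (t : nat).
Hypothesis ltGt : #|G| < t.
Local Notation Gs := (Gamma_star 1 t G).

Lemma seq_in_set w : all (mem G) w -> [set z in w] \subset G.
Proof. by move/allP=> wG; apply/subsetP=> z; rewrite inE => /wG. Qed.

Lemma gen_enum_pad (A : {set gT}) x :
  <<x |: [set z in pad t (enum A)]>> = <<x |: A>>.
Proof. by rewrite gen_pad; congr <<_ |: _>>; apply/setP=> z; rewrite inE mem_enum. Qed.

Lemma cogen_word (A : {set gT}) : A \subset G -> cogen G A != set0 ->
  exists2 v : Gs, size (word v) = t & cogen G [set z in word v] = cogen G A.
Proof.
move=> sAG /set0Pn[x /setIdP[Gx genG]].
have sz_p : size (pad t (enum A)) = t.
  by rewrite size_pad // -cardE (leq_trans (subset_leq_card sAG)) // ltnW.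
have AG : all (mem G) (enum A) by apply/allP=> z; rewrite mem_enum; apply: (subsetP sAG).
have [v eq_v] : exists v : Gs, word v = pad t (enum A).
  apply: (@word_surj _ _ _ _ [:: x]); rewrite ?pad_in //= ?andbT //.
  by rewrite joint_generationC joint_generation1 // gen_enum_pad.
exists v; rewrite ?eq_v //; apply/setP=> z; rewrite !inE; congr (_ && _).
by rewrite gen_enum_pad.
Qed.

Lemma single_vertex x : x \in G -> exists v : Gs, word v = [:: x].
Proof.
move=> Gx; apply: (@word_surj _ _ _ _ (pad t (enum G))).
- by rewrite /= Gx.
- by apply: pad_in; apply/allP=> z; rewrite mem_enum.
rewrite joint_generation1 ?gen_enum_pad ?size_pad -?cardE ?(ltnW ltGt) //.
by rewrite (setUidPr _) ?genGid // sub1set.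
Qed.

Lemma adj_single (v u : Gs) x : word v = [:: x] -> size (word u) = t ->
  adj v u = (x \in cogen G [set z in word u]).
Proof.
move=> eq_v sz_u; rewrite adj_word eq_v joint_generation1 // inE.
by have := word_in v; rewrite eq_v /= andbT => ->.
Qed.

Lemma t_neq1 : (t == 1%N) = false.
Proof. by apply/eqP=> t1; move: ltGt; rewrite t1 ltnNge cardG_gt0. Qed.

Lemma star_color (u v : Gs) :
  adj u v -> (size (word u) == 1%N) = ~~ (size (word v) == 1%N).
Proof.
by rewrite adj_word => /andP[/orP[]/andP[/eqP-> /eqP->] _]; rewrite !eqxx t_neq1.
Qed.

Lemma size1_word (v : Gs) :
  size (word v) == 1%N -> exists2 x, x \in G & word v = [:: x].
Proof.
by have := word_in v; case: (word v) => [|x [|y w]] //= /andP[Gx _] _; exists x.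
Qed.

Lemma star_neighbour (u : Gs) : exists v : Gs, adj u v.
Proof.
have := valP u; rewrite inE => /existsP[v adj_uv].
have nv : v \in nonisolated (Gamma 1 t G).
  by rewrite inE; apply/existsP; exists (val u); rewrite adjC.
by exists (Sub v nv).
Qed.

(** A generating tuple is adjacent to every element of [G], and every other tuple
    which is a vertex is adjacent to some element of [G]. *)
Lemma star_connected (u v : Gs) : connect (@adj Gs) u v.
Proof.
have cG : cogen G G = G.
  apply/setP=> x; rewrite inE; case Gx: (x \in G) => //=.
  by rewrite (setUidPr _) ?sub1set // genGid eqxx.
have ntcG : cogen G G != set0 by rewrite cG; apply/set0Pn; exists 1.
have [v0 sz_v0 cv0] := cogen_word (subxx G) ntcG; rewrite cG in cv0.
have symC := sym_connect_sym (@adjC Gs).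
have con1 (w : Gs) : size (word w) == 1%N -> connect (@adj Gs) v0 w.
  case/size1_word=> x Gx eq_w; rewrite symC connect1 //.
  by rewrite (adj_single eq_w sz_v0) cv0.
have con w : connect (@adj Gs) v0 w.
  have [/con1 // | nsz_w] := boolP (size (word w) == 1%N).
  have [z adj_wz] := star_neighbour w; apply: (connect_trans (con1 z _)).
    by rewrite -[_ == _]negbK -(star_color adj_wz).
  by rewrite symC connect1.
by apply: connect_trans (con v); rewrite symC.
Qed.

Lemma component_full (C : {set Gs}) : C \in components Gs -> C = setT.
Proof.
by case/imsetP=> x _ ->; apply/setP=> y; rewrite !inE star_connected.
Qed.

Lemma full_component : [set: Gs] \in components Gs.
Proof.
have [v _] := single_vertex (group1 G); apply/imsetP; exists v => //.
by apply/setP=> y; rewrite !inE star_connected.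
Qed.

End Connected.

Section Pigeonhole.

Variables (gT hT : finGroupType) (G : {group gT}) (H : {group hT}).

(** Only finitely many indices of the family of [H] have a label at most [n], while
    infinitely many indices of the family of [G] have a label above [m]. *)
Lemma large_labels (phi : Lambda1_index G -> Lambda1_index H) m n :
    injective phi ->
  exists i, m < projT1 i /\ n < projT1 (phi i).
Proof.
move=> inj_phi; pose m' := maxn m #|G|.
have ltG k : #|G| < (m' + k).+1 by rewrite ltnS (leq_trans (leq_maxr m _)) ?leq_addr.
pose ind k : Lambda1_index G :=
  existT _ (m' + k).+1
    (exist _ [set: Gamma_star 1 (m' + k).+1 G] (full_component (ltG k))).
pose T := {t : 'I_n.+1 & {C : {set Gamma_star 1 t H} |
                           C \in components (Gamma_star 1 t H)}}.
pose has_large := [exists k : 'I_#|{: T}|.+1, n < projT1 (phi (ind k))].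
have [/existsP[k ltk] | small] := boolP has_large.
  by exists (ind k); split; rewrite //= ltnS (leq_trans (leq_maxl m #|G|)) ?leq_addr.
have {}small (k : 'I_#|{: T}|.+1) : projT1 (phi (ind k)) < n.+1.
  by rewrite ltnS leqNgt; apply: contra small => ltk; apply/existsP; exists k.
pose code k : T := existT _ (Ordinal (small k)) (projT2 (phi (ind k))).
pose decode (c : T) : Lambda1_index H := existT _ (projT1 c : nat) (projT2 c).
have codeK k : decode (code k) = phi (ind k) by rewrite /decode /code /=; case: (phi _).
have inj_code : injective code.
  move=> k1 k2 /(congr1 decode); rewrite !codeK => /inj_phi.
  by move/(congr1 (@projT1 _ _)) => /= [] /addnI/val_inj.
by have := leq_card code inj_code; rewrite card_ord ltnn.
Qed.

End Pigeonhole.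

Section TwoSides.

Variables (gT : finGroupType) (G : {group gT}) (t : nat).
Hypothesis ltGt : #|G|.+1 < t.
Local Notation Gs := (Gamma_star 1 t G).

Lemma card_singles : #|[set v : Gs | size (word v) == 1%N]| = #|G|.
Proof.
pose h (v : Gs) := head 1 (word v).
have ltG := ltnW ltGt.
rewrite -(@card_in_imset _ _ h); last first.
  move=> u v; rewrite !inE => /size1_word[x _ eq_u] /size1_word[y _ eq_v].
  by rewrite /h eq_u eq_v /= => eq_xy; apply: word_inj; rewrite eq_u eq_v eq_xy.
apply: eq_card => x; apply/imsetP/idP => [[v] | Gx].
  by rewrite inE => /size1_word[y Gy eq_v] ->; rewrite /h eq_v.
have [v eq_v] := single_vertex ltG Gx.
by exists v; rewrite ?inE /h eq_v.
Qed.

(** Padding [x :: y :: enum G] gives a generating tuple for each pair [(x, y)]. *)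
Lemma card_tuples : #|G| ^ 2 <= #|[set v : Gs | size (word v) != 1%N]|.
Proof.
have ltG := ltnW ltGt.
pose h (v : Gs) := (nth 1 (word v) 0, nth 1 (word v) 1).
rewrite -mulnn -cardsX; apply: leq_trans (leq_imset_card h _).
apply: subset_leq_card; apply/subsetP=> [[x y]] /setXP[Gx Gy].
pose w := pad t (x :: y :: enum G).
have sz_w : size w = t by rewrite size_pad //= -cardE.
have sG z : z \in x :: y :: enum G -> z \in G.
  by rewrite !inE mem_enum => /or3P[/eqP->|/eqP->|].
have [v eq_v] : exists v : Gs, word v = w.
  have wG : all (mem G) w by apply: pad_in; apply/allP.
  have G1 : all (mem G) [:: 1] by rewrite /= group1.
  apply: word_surj wG G1 _.
  rewrite joint_generationC joint_generation1 // gen_pad eqEsubset gen_subG.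
  apply/andP; split.
    by apply/subsetP=> z /setU1P[-> // | ]; rewrite inE => /sG.
  apply: subset_trans (subset_gen _); apply/subsetP=> z Gz.
  by rewrite !inE mem_enum Gz !orbT.
apply/imsetP; exists v; last by rewrite /h eq_v.
by rewrite inE eq_v sz_w (t_neq1 ltG).
Qed.

End TwoSides.

Section StarIsomorphism.

Variables (gT hT : finGroupType) (G : {group gT}) (H : {group hT}) (t s : nat).
Hypotheses (ltGt : #|G|.+1 < t) (ltHs : #|H|.+1 < s).
Variable psi : Gamma_star 1 t G -> Gamma_star 1 s H.
Hypotheses (bij_psi : bijective psi)
           (adj_psi : forall u v, adj (psi u) (psi v) = adj u v).

Let ltG : #|G| < t := ltnW ltGt.
Let ltH : #|H| < s := ltnW ltHs.

(** The side of a connected bipartite graph on which a vertex lies is determined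
    up to a global exchange. *)
Lemma star_iso_sides u v :
  (size (word u) == 1%N) (+) (size (word (psi u)) == 1%N)
    = (size (word v) == 1%N) (+) (size (word (psi v)) == 1%N).
Proof.
pose a := [pred w | (size (word w) == 1%N) (+) (size (word (psi w)) == 1%N)].
suff cla : closed (@adj (Gamma_star 1 t G)) a.
  exact: (closed_connect cla (star_connected ltG u v)).
move=> x y adj_xy; rewrite !inE (star_color ltG adj_xy).
have adj_pxy : adj (psi x) (psi y) by rewrite adj_psi.
by rewrite (star_color ltH adj_pxy) addNb addbN negbK.
Qed.

(** Exchanged sides have equal sizes, whence [#|G| ^ 2 <= #|H|] and
    [#|H| ^ 2 <= #|G|]. *)
Lemma star_iso_exchange_trivial :
    (forall u, (size (word (psi u)) == 1%N) = (size (word u) != 1%N)) ->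
  G :=: 1 /\ H :=: 1.
Proof.
move=> exch.
have card_im (B : {set Gamma_star 1 s H}) : #|psi @^-1: B| = #|B|.
  by rewrite on_card_preimset //; case: bij_psi => psi' psiK psi'K; exists psi' => x _.
have leGH : #|G| ^ 2 <= #|H|.
  rewrite (leq_trans (card_tuples ltGt)) // -(card_singles ltHs) -card_im.
  by apply: subset_leq_card; apply/subsetP=> u; rewrite !inE exch.
have leHG : #|H| ^ 2 <= #|G|.
  rewrite (leq_trans (card_tuples ltHs)) // -(card_singles ltGt) -card_im.
  by apply: subset_leq_card; apply/subsetP=> u; rewrite !inE exch negbK.
have Ggt0 := cardG_gt0 G; have Hgt0 := cardG_gt0 H.
have leG : #|G| <= #|G| ^ 2 by rewrite -mulnn leq_pmulr.
have leH : #|H| <= #|H| ^ 2 by rewrite -mulnn leq_pmulr.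
split; apply: card1_trivg; apply/eqP; rewrite eqn_leq cardG_gt0 andbT.
  by rewrite -(leq_pmul2l Ggt0) muln1 mulnn (leq_trans leGH) ?(leq_trans leH).
by rewrite -(leq_pmul2l Hgt0) muln1 mulnn (leq_trans leHG) ?(leq_trans leG).
Qed.

Lemma star_iso_sides_maximal_bijection :
    (forall u, (size (word (psi u)) == 1%N) = (size (word u) == 1%N)) ->
  exists f, maximal_bijection G H f.
Proof.
move=> cc; have inj_psi := bij_inj bij_psi.
have [psi' psiK psi'K] := bij_psi.
have [v1 eq_v1] := single_vertex ltG (group1 G).
pose vert x := odflt v1 [pick v : Gamma_star 1 t G | word v == [:: x]].
have vertE x : x \in G -> word (vert x) = [:: x].
  move=> Gx; rewrite /vert; case: pickP => [v /eqP // | none].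
  by have [v eq_v] := single_vertex ltG Gx; have := none v; rewrite eq_v eqxx.
pose f x := head 1 (word (psi (vert x))).
have fE x : x \in G -> f x \in H /\ word (psi (vert x)) = [:: f x].
  move=> Gx; have : size (word (psi (vert x))) == 1%N by rewrite cc vertE.
  by case/size1_word=> y Hy eq_y; rewrite /f eq_y.
have injf : {in G &, injective f}.
  move=> x y Gx Gy eq_f; have [[_ eq_x] [_ eq_y]] := (fE x Gx, fE y Gy).
  have /inj_psi/(congr1 (@word _ _ _)) : psi (vert x) = psi (vert y).
    by apply: word_inj; rewrite eq_x eq_y eq_f.
  by rewrite !vertE // => -[].
have imf : f @: G = H.
  apply/setP=> y; apply/imsetP/idP => [[x Gx ->] | Hy]; first by have [] := fE x Gx.
  have [v eq_v] := single_vertex ltH Hy.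
  have : size (word (psi' v)) == 1%N by rewrite -cc psi'K eq_v.
  case/size1_word=> x Gx eq_x; exists x => //.
  have defv : psi' v = vert x by apply: word_inj; rewrite eq_x vertE.
  by have [_] := fE x Gx; rewrite -defv psi'K eq_v => -[].
have cog u : size (word u) = t -> size (word (psi u)) = s ->
    f @: cogen G [set z in word u] = cogen H [set z in word (psi u)].
  move=> sz_u sz_pu; have memc x : x \in G ->
      (f x \in cogen H [set z in word (psi u)]) = (x \in cogen G [set z in word u]).
    move=> Gx; have [Hfx eq_fx] := fE x Gx.
    by rewrite -(adj_single eq_fx sz_pu) adj_psi (adj_single (vertE x Gx) sz_u).
  apply/setP=> y; apply/imsetP/idP => [[x cx ->] | cy].
    by rewrite memc //; case/setIdP: cx.
  have Hy : y \in H by case/setIdP: cy.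
  move: Hy; rewrite -{1}imf => /imsetP[x Gx def_y].
  by exists x; rewrite // -memc -?def_y.
have sz_psi u : (size (word u) == t) = (size (word (psi u)) == s).
  have not1 (kT : finGroupType) (K : {group kT}) k (ltK : #|K| < k)
      (v : Gamma_star 1 k K) : (size (word v) == k) = (size (word v) != 1%N).
    have := size_word v; have [/eqP-> _ | _ /= ->] // := boolP (size _ == 1%N).
    by rewrite eq_sym (t_neq1 ltK).
  by rewrite (not1 _ _ _ ltG) (not1 _ _ _ ltH) cc.
exists f; apply: cogen_bijection_maximal => // [A sAG ntA | B sBH ntB].
  have [u sz_u <-] := cogen_word ltG sAG ntA.
  exists [set z in word (psi u)]; first exact: seq_in_set (word_in _).
  by apply: cog => //; apply/eqP; rewrite -sz_psi sz_u.
have [v sz_v <-] := cogen_word ltH sBH ntB.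
exists [set z in word (psi' v)]; first exact: seq_in_set (word_in _).
by rewrite -{2}(psi'K v); apply: cog; [apply/eqP; rewrite sz_psi|]; rewrite psi'K sz_v.
Qed.

End StarIsomorphism.

Lemma star_iso_maximal_bijection (gT hT : finGroupType) (G : {group gT})
    (H : {group hT}) t s :
    #|G|.+1 < t -> #|H|.+1 < s ->
    lgraph_iso (Gamma_star 1 t G) (Gamma_star 1 s H) ->
  exists f, maximal_bijection G H f.
Proof.
move=> ltGt ltHs [psi bij_psi adj_psi].
have [v1 _] := single_vertex (ltnW ltGt) (group1 G).
have sides := star_iso_sides ltGt ltHs adj_psi^~ v1.
have [exch | keep] := boolP ((size (word v1) == 1%N) (+) (size (word (psi v1)) == 1%N)).
  have [|G1 H1] := star_iso_exchange_trivial ltGt ltHs bij_psi.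
    by move=> u; have := sides u; rewrite exch; do 2 case: (_ == 1%N).
  exists (fun=> 1); split=> [x y | | M | K].
  - by rewrite G1 => /set1P-> /set1P->.
  - by rewrite G1 H1 imset_set1.
  - by move=> /maxgroupp; rewrite G1 properE sub1G andbF.
  - by move=> /maxgroupp; rewrite H1 properE sub1G andbF.
apply: (star_iso_sides_maximal_bijection ltGt ltHs bij_psi adj_psi) => u.
by have := sides u; rewrite (negPf keep); do 2 case: (_ == 1%N).
Qed.

Lemma Lambda1_star (gT : finGroupType) (G : {group gT}) (i : Lambda1_index G) :
  #|G| < projT1 i -> lgraph_iso (Lambda1 i) (Gamma_star 1 (projT1 i) G).
Proof.
case: i => t [C memC] /= ltGt; rewrite /Lambda1 /=.
rewrite (component_full ltGt memC); exact: induced_setT.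
Qed.

(** Two members of the families matched by the given bijection are connected
    graphs with large labels, so they are whole graphs [Gamma_star]. *)
Lemma same_Lambda1_maximal_bijection (gT hT : finGroupType) (G : {group gT})
    (H : {group hT}) :
  same_Lambda1 G H -> exists f, maximal_bijection G H f.
Proof.
case=> phi bij_phi iso_phi.
have [i [ltGt ltHs]] := large_labels #|G|.+1 #|H|.+1 (bij_inj bij_phi).
apply: (star_iso_maximal_bijection ltGt ltHs).
apply: lgraph_iso_trans (lgraph_iso_sym (Lambda1_star (ltnW ltGt))) _.
exact: lgraph_iso_trans (iso_phi i) (Lambda1_star (ltnW ltHs)).
Qed.

Theorem theorem5p20 (gT hT : finGroupType) (G : {group gT}) (H : {group hT})
    (eqLambda : same_Lambda1 G H) :
  [/\ #|G| = #|H|,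
      'm(G) = 'm(H),
      forall (R : realType) (s : R[i]), dirichlet_poly G s = dirichlet_poly H s,
      #|'Phi(G)| = #|'Phi(H)|
    & [/\ solvable G <-> solvable H,
          supersolvable G <-> supersolvable H
        & nilpotent G <-> nilpotent H]].
Proof.
have [f maxf] := same_Lambda1_maximal_bijection eqLambda.
(* The reverse bijection supplies the opposite inequalities and implications. *)
have [g maxg] := same_Lambda1_maximal_bijection (same_Lambda1_sym eqLambda).
split.
- exact: maximal_bijection_card maxf.
- apply/eqP; rewrite eqn_leq.
  by rewrite (maximal_bijection_grank maxf) (maximal_bijection_grank maxg).
- by move=> R s; apply: maximal_bijection_dirichlet_poly maxf R s.
- apply/eqP; rewrite eqn_leq.
  by rewrite (maximal_bijection_Phi maxf) (maximal_bijection_Phi maxg).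
split; split.
- exact: maximal_bijection_solvable maxf.
- exact: maximal_bijection_solvable maxg.
- exact: maximal_bijection_supersolvable maxf.
- exact: maximal_bijection_supersolvable maxg.
- exact: maximal_bijection_nilpotent maxf.
- exact: maximal_bijection_nilpotent maxg.
Qed.
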